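(* Assume $p\ge 3$ and $\lambda>0$. For some $\alpha>0$ and for each of the boundary conditions (i) $u(-\alpha)=u(\alpha)=0$ (Dirichlet), (ii) $u'(-\alpha)=u'(\alpha)=0$ (Neumann), (iii) $u(-\alpha)=u'(\alpha)=0$ (mixed-1), (iv) $u'(-\alpha)=u(\alpha)=0$ (mixed-2), there exists a unique positive solution of the equation $$u''-uu'+u|u|^{p-1}-\lambda u=0\quad\text{in }(-\alpha,\alpha).$$
   Context: Here $u$ is a real-valued function of one real variable. A solution on an interval is a function of class $\mathcal{C}^2$ satisfying the equation in the classical sense; the solution is also required to satisfy the boundary condition in question. *)

(* Defs.v *)
From Stdlib Require Import Reals.
From Coquelicot Require Import Coquelicot.
Open Scope R_scope.

Definition Icc (a b x : R) : Prop := a <= x <= b.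

(* Derivative relative to [D]: one-sided at the endpoints of a closed
   interval, the usual derivative at interior points. *)
Definition is_derive_within (D : R -> Prop) (f : R -> R) (x l : R) : Prop :=
  filterlim (fun y => (f y - f x) / (y - x)) (within D (locally' x)) (locally l).

(* [f] is of class C^2 on [D], with first and second derivatives [f1], [f2];
   continuity of [f] and [f1] follows from differentiability. *)
Definition is_C2_on (D : R -> Prop) (f f1 f2 : R -> R) : Prop :=
  (forall x, D x -> is_derive_within D f x (f1 x)) /\
  (forall x, D x -> is_derive_within D f1 x (f2 x)) /\
  continuous_on D f2.

Inductive boundary_condition : Set := Dirichlet | Neumann | Mixed1 | Mixed2.

Definition satisfies_bc (bc : boundary_condition) (alpha : R) (u u1 : R -> R)
  : Prop :=
  match bc with
  | Dirichlet => u (- alpha) = 0 /\ u alpha = 0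
  | Neumann => u1 (- alpha) = 0 /\ u1 alpha = 0
  | Mixed1 => u (- alpha) = 0 /\ u1 alpha = 0
  | Mixed2 => u1 (- alpha) = 0 /\ u alpha = 0
  end.

(* [Rpower 0 _] has a junk value, but the factor [u x] makes the power term
   vanish wherever [u x = 0], as it should. *)
Definition is_solution (p lambda alpha : R) (bc : boundary_condition)
    (u : R -> R) : Prop :=
  exists u1 u2 : R -> R,
    is_C2_on (Icc (- alpha) alpha) u u1 u2 /\
    (forall x, - alpha < x < alpha ->
       u2 x - u x * u1 x + u x * Rpower (Rabs (u x)) (p - 1) - lambda * u x = 0) /\
    satisfies_bc bc alpha u u1.

(* Positivity is required on the open interval only, since [u] may have to
   vanish at the endpoints. *)
Definition is_positive_solution (p lambda alpha : R) (bc : boundary_condition)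
    (u : R -> R) : Prop :=
  is_solution p lambda alpha bc u /\ (forall x, - alpha < x < alpha -> 0 < u x).

(* Main.v *)
Require Import Defs.
From Stdlib Require Import Reals Lra Lia ClassicalEpsilon.
From Coquelicot Require Import Coquelicot.
Open Scope R_scope.

(** The term [u u'] leaves no first integral to integrate, so descent times are not computed by
    quadrature but compared through differential inequalities. It also breaks the symmetry
    [t |-> - t]: descending on the left of a peak means solving, to the right, the equation with the
    opposite sign of [u u']. Hence the coefficient [sigma], finally taken to be [1] and [-1], and
    hence the extra work for the Dirichlet problem, where the peak need not be at the centre.

    A single length [l], produced by the Neumann rigidity, serves all four problems with
    [alpha = l / 2]. What shortness buys elsewhere is monotonicity: a second critical point along a
    descent would bound an interval with [u' = 0] at both ends.

    The condition [p >= 3] acts twice, each time because the power dominates a square: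
    [u^(p-1) >= u^2 - 1] absorbs the contribution of [u u'] to the Riccati inequality, and
    [k^(p-1) >= k^2] makes the dilation comparison work.

    Shooting uses continuity in the peak only for the value of [u] at a fixed time. Continuity of
    the descent times follows instead from their monotonicity and from the fact that every length is
    attained. *)

(** Along a positive solution the slope [r = u'/u] satisfies
    [r' = u r - r^2 - u^(p-1) + lambda <= 1 + lambda - (u^2 + r^2) / 2].
    On short intervals this bounds every solution with [u' = 0] at both ends and
    then forces it to be constant, which settles the Neumann problem and shows
    that in the other three problems [u] descends monotonically from a peak
    [(m, 0)] to [0] on each side of it. As [p >= 3], the dilation
    [k u(k t)], [k > 1], weakens the nonlinearity and keeps the term [u u'], so a
    comparison in the phase plane shows that the time of descent is a strictly
    decreasing function of [m]: this is uniqueness. Existence is by shooting from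
    the peak: the same Riccati inequality makes the descent arbitrarily fast for
    large [m]. For the Dirichlet problem, the two one-sided descent times are
    continuous in [m], and their sum takes the value [2 alpha]. *)

(** * Calculus on an interval *)

Lemma mvt_open (f df : R -> R) (a b : R) :
  a < b -> (forall x, a < x < b -> is_derive f x (df x)) ->
  (forall x, a <= x <= b -> continuity_pt f x) ->
  exists c, a < c < b /\ f b - f a = df c * (b - a).
Proof.
intros hab hd hc.
assert (pr : forall c, a < c < b -> derivable_pt f c).
{ intros c hcab; exists (df c); apply is_derive_Reals; auto. }
destruct (MVT f id a b pr (fun c _ => derivable_pt_id c) hab hc) as [c [P e]].
{ intros; apply derivable_continuous_pt, derivable_pt_id. }
exists c; split; [exact P|].
rewrite derive_pt_id in e; unfold id in e.
assert (ed : derive_pt f c (pr c P) = df c).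
{ apply derive_pt_eq_0, is_derive_Reals; auto. }
rewrite ed in e; lra.
Qed.

Lemma increment_le (f df : R -> R) (a b K : R) :
  a <= b -> (forall x, a < x < b -> is_derive f x (df x)) ->
  (forall x, a <= x <= b -> continuity_pt f x) ->
  (forall x, a < x < b -> df x <= K) -> f b - f a <= K * (b - a).
Proof.
intros [hab | ->] hd hc hK; [|lra].
destruct (mvt_open f df a b hab hd hc) as [c [hcab ->]].
apply Rmult_le_compat_r; [lra | auto].
Qed.

Lemma increment_lt (f df : R -> R) (a b K : R) :
  a < b -> (forall x, a < x < b -> is_derive f x (df x)) ->
  (forall x, a <= x <= b -> continuity_pt f x) ->
  (forall x, a < x < b -> df x < K) -> f b - f a < K * (b - a).
Proof.
intros hab hd hc hK.
destruct (mvt_open f df a b hab hd hc) as [c [hcab ->]].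
apply Rmult_lt_compat_r; [lra | auto].
Qed.

Lemma increment_Rabs_le (f df : R -> R) (a b K : R) :
  a <= b -> (forall x, a < x < b -> is_derive f x (df x)) ->
  (forall x, a <= x <= b -> continuity_pt f x) ->
  (forall x, a < x < b -> Rabs (df x) <= K) -> Rabs (f b - f a) <= K * (b - a).
Proof.
intros [hab | ->] hd hc hK.
- destruct (mvt_open f df a b hab hd hc) as [c [hcab ->]].
  rewrite Rabs_mult, (Rabs_pos_eq (b - a)) by lra.
  apply Rmult_le_compat_r; [lra | auto].
- rewrite Rminus_diag, Rabs_R0; lra.
Qed.

Lemma is_derive_continuity_pt (f : R -> R) (x l : R) :
  is_derive f x l -> continuity_pt f x.
Proof.
intros h; apply derivable_continuous_pt; exists l; apply is_derive_Reals, h.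
Qed.

Lemma continuity_pt_eps (f : R -> R) (x : R) :
  continuity_pt f x <->
  forall eps, 0 < eps -> exists delta, 0 < delta /\
    forall y, Rabs (y - x) < delta -> Rabs (f y - f x) < eps.
Proof.
split.
- intros h eps he; destruct (h eps he) as [d [hd H]].
  exists d; split; [exact hd|]; intros y hy.
  destruct (Req_dec x y) as [<- | hne].
  + rewrite Rminus_diag, Rabs_R0; exact he.
  + apply H; split; [split; [exact I | exact hne] | exact hy].
- intros h eps he; destruct (h eps he) as [d [hd H]].
  exists d; split; [exact hd|]; intros y [_ hy]; apply H, hy.
Qed.

(** The hitting point is the supremum of the points up to which [f] stays below [c]; by continuity
    its value can be neither smaller nor larger than [c]. Applied to [- f], the lemma handles
    descents. *)
Lemma first_hit (f : R -> R) (a b c : R) :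
  a <= b -> (forall x, a <= x <= b -> continuity_pt f x) -> f a < c <= f b ->
  exists t, a < t <= b /\ f t = c /\ forall s, a <= s < t -> f s < c.
Proof.
intros hab hc [ha hb].
set (E := fun x => a <= x <= b /\ forall s, a <= s <= x -> f s < c).
assert (Ea : E a).
{ split; [lra|]; intros s hs; replace s with a by lra; exact ha. }
destruct (completeness E) as [t [ub lub]].
{ exists b; intros x [hx _]; lra. }
{ exists a; exact Ea. }
assert (hat : a <= t) by (apply ub, Ea).
assert (htb : t <= b) by (apply lub; intros x [hx _]; lra).
assert (below : forall s, a <= s < t -> f s < c).
{ intros s hs; apply Rnot_le_lt; intros hcs.
  assert (t <= s); [|lra].
  apply lub; intros x [hx Hx]; apply Rnot_lt_le; intros hsx.
  specialize (Hx s); lra. }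
assert (ft : f t = c).
{ destruct (Rtotal_order (f t) c) as [hlt | [-> | hgt]]; [|reflexivity|].
  - destruct (proj1 (continuity_pt_eps f t) (hc t (conj hat htb)) (c - f t))
      as [d [hd H]]; [lra|].
    assert (htb' : t < b) by (destruct htb as [? | ->]; lra).
    assert (E (Rmin b (t + d / 2))).
    { split.
      - split; [apply Rmin_glb; lra | apply Rmin_l].
      - intros s hs; destruct (Rlt_le_dec s t) as [h | h]; [apply below; lra|].
        assert (s <= t + d / 2) by (eapply Rle_trans; [apply hs | apply Rmin_r]).
        assert (Rabs (f s - f t) < c - f t) by (apply H; apply Rabs_def1; lra).
        apply Rabs_def2 in H1; lra. }
    apply ub in H0; revert H0; apply Rmin_case; intros; lra.
  - destruct (proj1 (continuity_pt_eps f t) (hc t (conj hat htb)) (f t - c))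
      as [d [hd H]]; [lra|].
    assert (hat' : a < t) by (destruct hat as [? | <-]; lra).
    set (s := Rmax a (t - d / 2)).
    assert (hs : a <= s < t /\ t - d / 2 <= s).
    { unfold s; repeat split; [apply Rmax_l | apply Rmax_lub_lt; lra | apply Rmax_r]. }
    assert (Hs : Rabs (f s - f t) < f t - c) by (apply H; apply Rabs_def1; lra).
    apply Rabs_def2 in Hs; specialize (below s); lra. }
exists t; split; [|split; assumption].
split; [|exact htb]; destruct hat as [h | <-]; [exact h | lra].
Qed.

Definition clamp (a b x : R) : R := Rmax a (Rmin b x).

Lemma clamp_bounds (a b x : R) : a <= b -> a <= clamp a b x <= b.
Proof.
intros h; unfold clamp; split; [apply Rmax_l|].
apply Rmax_lub; [exact h | apply Rmin_l].
Qed.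

Lemma clamp_id (a b x : R) : a <= x <= b -> clamp a b x = x.
Proof.
intros h; unfold clamp; rewrite Rmin_right, Rmax_right by lra; reflexivity.
Qed.

Lemma clamp_lipschitz (a b x y : R) : Rabs (clamp a b x - clamp a b y) <= Rabs (x - y).
Proof.
unfold clamp, Rmax, Rmin.
repeat destruct Rle_dec; unfold Rabs; repeat destruct Rcase_abs; lra.
Qed.

(* The inverse is extended by constants, so that it is continuous everywhere. *)
Lemma decreasing_inverse (f : R -> R) (a b : R) :
  a < b -> (forall x, a <= x <= b -> continuity_pt f x) ->
  (forall x y, a <= x -> x < y -> y <= b -> f y < f x) ->
  exists g : R -> R,
    (forall y, a <= g y <= b /\ f (g y) = clamp (f b) (f a) y) /\
    (forall y, continuity_pt g y) /\
    (forall y l, f b < y < f a -> is_derive f (g y) l -> l <> 0 ->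
       is_derive g y (/ l)).
Proof.
intros hab hc hdec.
assert (hfab : f b < f a) by (apply hdec; lra).
assert (ex : forall y, exists x, a <= x <= b /\ f x = clamp (f b) (f a) y).
{ intros y; destruct (clamp_bounds (f b) (f a) y) as [hl hu]; [lra|].
  destruct hu as [hu | hu].
  - destruct (first_hit (fun x => - f x) a b (- clamp (f b) (f a) y))
      as [t [ht [e _]]]; [lra | | lra |].
    + intros x hx; apply continuity_pt_opp; auto.
    + exists t; split; lra.
  - exists a; split; lra. }
set (g := fun y => proj1_sig (constructive_indefinite_description _ (ex y))).
assert (hg : forall y, a <= g y <= b /\ f (g y) = clamp (f b) (f a) y).
{ intros y; exact (proj2_sig (constructive_indefinite_description _ (ex y))). }
clearbody g.
assert (inj : forall x y, a <= x <= b -> a <= y <= b -> f x <= f y -> y <= x).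
{ intros x y hx hy h; apply Rnot_lt_le; intros hxy.
  specialize (hdec x y); lra. }
assert (gc : forall y, continuity_pt g y).
{ intros y; apply continuity_pt_eps; intros eps he.
  destruct (hg y) as [hgy egy].
  (* The radius is the drop of [f] between [g y] and [g y + eps]. As [clamp] is 1-Lipschitz, a
     closer argument cannot change the value of [f] along [g] by that much. If [g y + eps] leaves
     the interval there is nothing to exclude. *)
  assert (lo : exists d, 0 < d /\ forall z, Rabs (z - y) < d -> g z < g y + eps).
  { destruct (Rlt_le_dec b (g y + eps)) as [h | h].
    - exists 1; split; [lra|]; intros z _; destruct (hg z); lra.
    - assert (H := hdec (g y) (g y + eps)).
      exists (f (g y) - f (g y + eps)); split; [lra|].
      intros z hz; apply Rnot_le_lt; intros hh.
      destruct (hg z) as [hgz egz].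
      assert (f (g z) <= f (g y + eps)).
      { destruct hh as [hh | <-]; [|lra].
        apply Rlt_le, hdec; lra. }
      assert (Hl := clamp_lipschitz (f b) (f a) z y).
      rewrite <- egz, <- egy in Hl.
      assert (Rabs (f (g z) - f (g y)) < f (g y) - f (g y + eps)) by lra.
      apply Rabs_def2 in H1; lra. }
  assert (up : exists d, 0 < d /\ forall z, Rabs (z - y) < d -> g y - eps < g z).
  { destruct (Rlt_le_dec (g y - eps) a) as [h | h].
    - exists 1; split; [lra|]; intros z _; destruct (hg z); lra.
    - assert (H := hdec (g y - eps) (g y)).
      exists (f (g y - eps) - f (g y)); split; [lra|].
      intros z hz; apply Rnot_le_lt; intros hh.
      destruct (hg z) as [hgz egz].
      assert (f (g y - eps) <= f (g z)).
      { destruct hh as [hh | ->]; [|lra].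
        apply Rlt_le, hdec; lra. }
      assert (Hl := clamp_lipschitz (f b) (f a) z y).
      rewrite <- egz, <- egy in Hl.
      assert (Rabs (f (g z) - f (g y)) < f (g y - eps) - f (g y)) by lra.
      apply Rabs_def2 in H1; lra. }
  destruct lo as [d1 [hd1 H1]]; destruct up as [d2 [hd2 H2]].
  exists (Rmin d1 d2); split; [apply Rmin_glb_lt; assumption|].
  intros z hz.
  assert (Rabs (z - y) < d1) by (eapply Rlt_le_trans; [exact hz | apply Rmin_l]).
  assert (Rabs (z - y) < d2) by (eapply Rlt_le_trans; [exact hz | apply Rmin_r]).
  specialize (H1 z H); specialize (H2 z H0); apply Rabs_def1; lra. }
exists g; split; [exact hg | split; [exact gc|]].
intros y l hy hd hl.
(* The difference quotient [k / h] of [g] is the reciprocal of that of [f] over the step [k], which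
   tends to [0] with [h] because [g] is continuous. Continuity of [Rinv] at [l] then concludes. The
   radius keeps [y + h] in the range where clamping is the identity. *)
apply is_derive_Reals; apply is_derive_Reals in hd.
intros eps he.
assert (hinv : continuity_pt Rinv l).
{ apply continuity_pt_inv; [apply derivable_continuous_pt, derivable_pt_id | exact hl]. }
destruct (proj1 (continuity_pt_eps _ _) hinv eps he) as [d1 [hd1 H1]].
destruct (hd d1 hd1) as [d2 H2].
destruct (proj1 (continuity_pt_eps _ _) (gc y) d2 (cond_pos d2)) as [d3 [hd3 H3]].
assert (hd4 : 0 < Rmin d3 (Rmin (y - f b) (f a - y))).
{ repeat apply Rmin_glb_lt; lra. }
exists (mkposreal _ hd4); intros h hh hhd; simpl in hhd.
assert (Rabs h < d3) by (eapply Rlt_le_trans; [exact hhd | apply Rmin_l]).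
assert (hhd' : Rabs h < Rmin (y - f b) (f a - y))
  by (eapply Rlt_le_trans; [exact hhd | apply Rmin_r]).
assert (Rabs h < y - f b) by (eapply Rlt_le_trans; [exact hhd' | apply Rmin_l]).
assert (Rabs h < f a - y) by (eapply Rlt_le_trans; [exact hhd' | apply Rmin_r]).
apply Rabs_def2 in H0; apply Rabs_def2 in H4.
destruct (hg y) as [hgy egy]; destruct (hg (y + h)) as [hgz egz].
rewrite clamp_id in egy by lra; rewrite clamp_id in egz by lra.
set (k := g (y + h) - g y).
assert (hk0 : k <> 0).
{ unfold k; intros e; assert (e' : g (y + h) = g y) by lra.
  rewrite e' in egz; lra. }
assert (hkd : Rabs k < d2).
{ apply H3; replace (y + h - y) with h by ring; exact H. }
specialize (H2 k hk0 hkd).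
replace (g y + k) with (g (y + h)) in H2 by (unfold k; ring).
rewrite egz, egy in H2.
specialize (H1 _ H2).
replace (/ ((y + h - y) / k)) with (k / h) in H1; [exact H1|].
field; split; [exact hk0 | lra].
Qed.

(** * Picard iteration *)

Lemma is_derive_primitive (f : R -> R) (t : R) :
  (forall x, continuity_pt f x) -> is_derive (fun s => RInt f 0 s) t (f t).
Proof.
intros hf.
assert (hf' : forall x, continuous f x) by (intros; apply continuity_pt_filterlim, hf).
apply is_derive_RInt with (a := 0); [|apply hf'].
apply filter_forall; intros x.
apply RInt_correct, ex_RInt_continuous; auto.
Qed.

(** For [e = 1] and [e = -1], the function [e * f - B / k * exp (k s)] is nonincreasing and starts
    at [- B / k]. Integration thus divides by [k] in the norm weighted by [exp (k t)], which is what
    makes the Picard map contract. *)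
Lemma exp_growth_bound (f df : R -> R) (B k t : R) :
  0 < k -> 0 <= t -> f 0 = 0 -> (forall s, is_derive f s (df s)) ->
  (forall s, 0 <= s -> Rabs (df s) <= B * exp (k * s)) ->
  Rabs (f t) <= B / k * exp (k * t).
Proof.
intros hk ht f0 hd hb.
assert (hB : 0 <= B).
{ specialize (hb 0 (Rle_refl 0)); rewrite Rmult_0_r, exp_0 in hb.
  assert (H := Rabs_pos (df 0)); lra. }
assert (hBk : 0 <= B / k) by (apply Rmult_le_pos; [lra | apply Rlt_le, Rinv_0_lt_compat; lra]).
assert (step : forall e, Rabs e <= 1 -> e * f t <= B / k * exp (k * t)).
{ intros e he.
  set (g := fun s => e * f s - B / k * exp (k * s)).
  assert (hg : forall s, is_derive g s (e * df s - B * exp (k * s))).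
  { intros s; unfold g.
    apply (is_derive_minus (fun s => e * f s)).
    - apply is_derive_scal, hd.
    - auto_derive; [exact I | field; lra]. }
  assert (H : g t - g 0 <= 0 * (t - 0)).
  { apply increment_le with (df := fun s => e * df s - B * exp (k * s)); auto.
    - intros x _; eapply is_derive_continuity_pt, hg.
    - intros x hx; specialize (hb x (Rlt_le _ _ (proj1 hx))).
      assert (e * df x <= Rabs (df x)); [|lra].
      eapply Rle_trans; [apply Rle_abs|]; rewrite Rabs_mult.
      assert (H := Rabs_pos (df x)).
      apply Rle_trans with (1 * Rabs (df x)); [|lra].
      apply Rmult_le_compat_r; lra. }
  unfold g in H; rewrite f0, (Rmult_0_r k), exp_0 in H; lra. }
apply Rabs_le; split.
- assert (H := step (-1)); rewrite Rabs_left in H by lra; lra.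
- assert (H := step 1); rewrite Rabs_R1 in H; lra.
Qed.

Section Picard.
Variables (c d : R -> R) (C u0 z0 : R).
Hypothesis hC : 1 <= C.
Hypothesis hc : forall x y, Rabs (c x - c y) <= C * Rabs (x - y).
Hypothesis hd : forall x y, Rabs (d x - d y) <= C * Rabs (x - y).

Lemma lipschitz_continuity_pt (f : R -> R) (x : R) :
  (forall x y, Rabs (f x - f y) <= C * Rabs (x - y)) -> continuity_pt f x.
Proof.
intros hf; apply continuity_pt_eps; intros eps he.
exists (eps / C); split; [apply Rdiv_lt_0_compat; lra|].
intros y hy; eapply Rle_lt_trans; [apply hf|].
apply Rmult_lt_compat_l with (r := C) in hy; [|lra].
replace (C * (eps / C)) with eps in hy by (field; lra); exact hy.
Qed.

(** Integral form of [u' = z + c(u)], [z' = - d(u)]. The component [z] is eliminated, so that the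
    iteration acts on the single function [u]. *)
Definition picard_aux (w : R -> R) (s : R) : R := z0 - RInt (fun r => d (w r)) 0 s.

Definition picard (w : R -> R) (t : R) : R :=
  u0 + RInt (fun s => picard_aux w s + c (w s)) 0 t.

Lemma picard_aux_derive (w : R -> R) (s : R) :
  (forall x, continuity_pt w x) -> is_derive (picard_aux w) s (- d (w s)).
Proof.
intros hw; unfold picard_aux.
replace (- d (w s)) with (0 - d (w s)) by ring.
apply (is_derive_minus (fun _ => z0)); [apply (is_derive_const z0)|].
apply (is_derive_primitive (fun r => d (w r))); intros x.
apply (continuity_pt_comp w d); [apply hw | apply lipschitz_continuity_pt, hd].
Qed.

Lemma picard_derive (w : R -> R) (t : R) :
  (forall x, continuity_pt w x) -> is_derive (picard w) t (picard_aux w t + c (w t)).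
Proof.
intros hw; unfold picard.
replace (picard_aux w t + c (w t)) with (0 + (picard_aux w t + c (w t))) by ring.
apply (is_derive_plus (fun _ => u0)); [apply (is_derive_const u0)|].
apply (is_derive_primitive (fun s => picard_aux w s + c (w s))); intros x.
apply (continuity_pt_plus (picard_aux w)).
- eapply is_derive_continuity_pt, picard_aux_derive, hw.
- apply (continuity_pt_comp w c); [apply hw | apply lipschitz_continuity_pt, hc].
Qed.

Lemma picard_continuous (w : R -> R) :
  (forall x, continuity_pt w x) -> forall t, continuity_pt (picard w) t.
Proof. intros hw t; eapply is_derive_continuity_pt, picard_derive, hw. Qed.

Lemma picard_aux_0 (w : R -> R) : picard_aux w 0 = z0.
Proof. unfold picard_aux; rewrite (RInt_point 0); unfold zero; simpl; ring. Qed.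

Lemma picard_0 (w : R -> R) : picard w 0 = u0.
Proof. unfold picard; rewrite (RInt_point 0); unfold zero; simpl; ring. Qed.

(** With the weight [exp (4 C t)] the map contracts by [1/2] on the whole half-line, so solutions
    are global at once. Integrating [d] gives [A / 4], the term [c] gives [C A], their sum is at
    most [2 C A] since [1 <= C], and the outer integration divides by [4 C]. *)
Lemma picard_contraction (w1 w2 : R -> R) (A : R) :
  (forall x, continuity_pt w1 x) -> (forall x, continuity_pt w2 x) ->
  (forall t, 0 <= t -> Rabs (w1 t - w2 t) <= A * exp (4 * C * t)) ->
  forall t, 0 <= t -> Rabs (picard w1 t - picard w2 t) <= A / 2 * exp (4 * C * t).
Proof.
intros h1 h2 hA t ht.
assert (A0 : 0 <= A).
{ specialize (hA 0 (Rle_refl 0)); rewrite Rmult_0_r, exp_0 in hA.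
  assert (H := Rabs_pos (w1 0 - w2 0)); lra. }
assert (haux : forall s, 0 <= s ->
  Rabs (picard_aux w1 s - picard_aux w2 s) <= C * A / (4 * C) * exp (4 * C * s)).
{ intros s hs.
  apply (exp_growth_bound (fun s => picard_aux w1 s - picard_aux w2 s)
    (fun s => - d (w1 s) - - d (w2 s))); [lra | exact hs | | |].
  - rewrite !picard_aux_0; ring.
  - intros r; apply (is_derive_minus (picard_aux w1)); apply picard_aux_derive; assumption.
  - intros r hr; replace (- d (w1 r) - - d (w2 r)) with (d (w2 r) - d (w1 r)) by ring.
    eapply Rle_trans; [apply hd|]; rewrite Rmult_assoc.
    apply Rmult_le_compat_l; [lra|]; rewrite Rabs_minus_sym; auto. }
replace (A / 2) with (2 * C * A / (4 * C)) by (field; lra).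
apply (exp_growth_bound (fun t => picard w1 t - picard w2 t)
  (fun s => (picard_aux w1 s + c (w1 s)) - (picard_aux w2 s + c (w2 s)))); [lra | exact ht | | |].
- rewrite !picard_0; ring.
- intros r; apply (is_derive_minus (picard w1)); apply picard_derive; assumption.
- intros s hs.
  replace (picard_aux w1 s + c (w1 s) - (picard_aux w2 s + c (w2 s)))
    with ((picard_aux w1 s - picard_aux w2 s) + (c (w1 s) - c (w2 s))) by ring.
  eapply Rle_trans; [apply Rabs_triang|].
  assert (H1 := haux s hs).
  assert (H2 : Rabs (c (w1 s) - c (w2 s)) <= C * (A * exp (4 * C * s))).
  { eapply Rle_trans; [apply hc|]; apply Rmult_le_compat_l; [lra | auto]. }
  replace (C * A / (4 * C)) with (A / 4) in H1 by (field; lra).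
  assert (H3 : 0 <= A * exp (4 * C * s))
    by (apply Rmult_le_pos; [lra | apply Rlt_le, exp_pos]).
  nra.
Qed.

Fixpoint iterate (n : nat) : R -> R :=
  match n with O => fun _ => u0 | S n => picard (iterate n) end.

Lemma iterate_continuous (n : nat) (t : R) : continuity_pt (iterate n) t.
Proof.
revert t; induction n as [|n IH]; simpl.
- intros t; apply continuity_pt_const; intros x y; reflexivity.
- apply picard_continuous, IH.
Qed.

Lemma iterate_step :
  exists A, forall n t, 0 <= t ->
    Rabs (iterate (S n) t - iterate n t) <= A * (/ 2) ^ n * exp (4 * C * t).
Proof.
(* [B (1 + s)] bounds the derivative of the first correction, and [1 + s <= exp (4 C s)]. *)
set (B := Rabs (z0 + c u0) + Rabs (d u0)).
exists (B / (4 * C)); intros n; induction n as [|n IH]; intros t ht.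
- rewrite pow_O, Rmult_1_r.
  apply (exp_growth_bound (fun t => iterate 1 t - iterate 0 t)
    (fun s => (picard_aux (fun _ => u0) s + c u0) - 0)); [lra | exact ht | | |].
  + simpl; rewrite picard_0; ring.
  + intros s; apply (is_derive_minus (iterate 1)).
    * apply (picard_derive (fun _ => u0)); intros x.
      apply continuity_pt_const; intros y z; reflexivity.
    * apply (is_derive_const u0).
  + intros s hs.
    assert (E : picard_aux (fun _ => u0) s = z0 - s * d u0).
    { unfold picard_aux; rewrite RInt_const; unfold scal; simpl; unfold mult; simpl; ring. }
    rewrite E; replace (z0 - s * d u0 + c u0 - 0) with ((z0 + c u0) + - (s * d u0)) by ring.
    eapply Rle_trans; [apply Rabs_triang|].
    rewrite Rabs_Ropp, Rabs_mult, (Rabs_pos_eq s hs).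
    assert (H := exp_ineq1_le (4 * C * s)).
    assert (H1 := Rabs_pos (z0 + c u0)); assert (H2 := Rabs_pos (d u0)).
    assert (H3 : s <= 4 * C * s) by nra.
    apply Rle_trans with (B * (1 + s)); [unfold B; nra|].
    apply Rmult_le_compat_l; [unfold B|]; lra.
- simpl pow.
  replace (B / (4 * C) * (/ 2 * (/ 2) ^ n)) with (B / (4 * C) * (/ 2) ^ n / 2) by (field; lra).
  apply (picard_contraction (iterate (S n)) (iterate n)); auto using iterate_continuous.
Qed.

(** A geometric series; the exact partial sum [1 - (/ 2) ^ k] is kept so that the induction on [k]
    closes. *)
Lemma iterate_tail (A : R) :
  (forall n t, 0 <= t ->
    Rabs (iterate (S n) t - iterate n t) <= A * (/ 2) ^ n * exp (4 * C * t)) ->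
  forall n k t, 0 <= t ->
    Rabs (iterate (n + k) t - iterate n t)
    <= 2 * A * (/ 2) ^ n * (1 - (/ 2) ^ k) * exp (4 * C * t).
Proof.
intros hA n k t ht; induction k as [|k IH].
- rewrite Nat.add_0_r, Rminus_diag, Rabs_R0; simpl; lra.
- rewrite Nat.add_succ_r.
  replace (iterate (S (n + k)) t - iterate n t)
    with ((iterate (S (n + k)) t - iterate (n + k) t) + (iterate (n + k) t - iterate n t)) by ring.
  eapply Rle_trans; [apply Rabs_triang|].
  specialize (hA (n + k)%nat t ht); rewrite pow_add in hA.
  simpl pow; lra.
Qed.

Lemma picard_exists :
  exists u z : R -> R,
    (forall t, continuity_pt u t) /\ (forall t, continuity_pt z t) /\
    u 0 = u0 /\ z 0 = z0 /\
    (forall t, 0 < t -> is_derive u t (z t + c (u t))) /\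
    (forall t, 0 < t -> is_derive z t (- d (u t))).
Proof.
destruct iterate_step as [A hA].
assert (tail := iterate_tail A hA).
assert (A0 : 0 <= A).
{ specialize (hA 0%nat 0 (Rle_refl 0)); rewrite Rmult_0_r, exp_0 in hA; simpl pow in hA.
  assert (H := Rabs_pos (iterate 1 0 - iterate 0 0)); lra. }
assert (tail' : forall n k t, 0 <= t ->
  Rabs (iterate (n + k) t - iterate n t) <= 2 * A * (/ 2) ^ n * exp (4 * C * t)).
{ intros n k t ht; eapply Rle_trans; [apply tail, ht|].
  assert (H1 := pow_le (/ 2) n); assert (H2 := pow_le (/ 2) k).
  assert (H3 := exp_pos (4 * C * t)).
  apply Rmult_le_compat_r; [lra|].
  rewrite <- (Rmult_1_r (2 * A * (/ 2) ^ n)) at 2.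
  apply Rmult_le_compat_l; [|lra].
  apply Rmult_le_pos; lra. }
assert (small : forall K e, 0 < e -> exists n, K * (/ 2) ^ n < e).
{ intros K e he.
  destruct (pow_lt_1_zero (/ 2)) with (y := e / (Rabs K + 1)) as [N HN].
  { rewrite Rabs_pos_eq; lra. }
  { apply Rdiv_lt_0_compat; [lra|]; assert (H := Rabs_pos K); lra. }
  exists N; specialize (HN N (le_n N)).
  assert (hK := Rabs_pos K); assert (hK' := Rle_abs K).
  assert (hp := pow_lt (/ 2) N); rewrite Rabs_pos_eq in HN by lra.
  apply Rmult_lt_compat_l with (r := Rabs K + 1) in HN; [|lra].
  replace ((Rabs K + 1) * (e / (Rabs K + 1))) with e in HN by (field; lra).
  nra. }
(* The estimates hold for nonnegative times only. Freezing the limit at its value in [0] for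
   negative [t] makes it continuous on the whole line, as differentiating the primitives
   requires. *)
set (u := fun t => real (Lim_seq (fun n => iterate n (Rmax 0 t)))).
assert (ulim : forall t, is_lim_seq (fun n => iterate n (Rmax 0 t)) (u t)).
{ intros t; apply Lim_seq_correct', ex_lim_seq_cauchy_corr.
  intros eps; destruct (small (4 * A * exp (4 * C * Rmax 0 t)) eps (cond_pos eps)) as [N HN].
  exists N; intros n m hn hm.
  assert (H1 := tail' N (n - N)%nat (Rmax 0 t) (Rmax_l _ _)).
  assert (H2 := tail' N (m - N)%nat (Rmax 0 t) (Rmax_l _ _)).
  replace (N + (n - N))%nat with n in H1 by lia.
  replace (N + (m - N))%nat with m in H2 by lia.
  replace (iterate n (Rmax 0 t) - iterate m (Rmax 0 t))
    with ((iterate n (Rmax 0 t) - iterate N (Rmax 0 t))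
          - (iterate m (Rmax 0 t) - iterate N (Rmax 0 t))) by ring.
  eapply Rle_lt_trans; [apply Rabs_triang|]; rewrite Rabs_Ropp; lra. }
assert (uapprox : forall n t, 0 <= t ->
  Rabs (u t - iterate n t) <= 2 * A * (/ 2) ^ n * exp (4 * C * t)).
{ intros n t ht.
  assert (H := ulim t); rewrite Rmax_right in H by exact ht.
  apply is_lim_seq_incr_n with (N := n) in H.
  assert (H' := is_lim_seq_minus' _ _ _ _ H (is_lim_seq_const (iterate n t))).
  apply is_lim_seq_abs in H'.
  refine (is_lim_seq_le _ _ _ _ _ H' (is_lim_seq_const (2 * A * (/ 2) ^ n * exp (4 * C * t)))).
  intros k; simpl; rewrite Nat.add_comm; apply tail', ht. }
assert (uneg : forall t, u t = u (Rmax 0 t)).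
{ intros t; unfold u; rewrite (Rmax_right 0 (Rmax 0 t)) by apply Rmax_l; reflexivity. }
assert (ucont : forall t, continuity_pt u t).
{ intros t; apply continuity_pt_eps; intros eps he.
  set (T := Rmax 0 t + 1).
  destruct (small (2 * A * exp (4 * C * T)) (eps / 3)) as [n hn]; [lra|].
  destruct (proj1 (continuity_pt_eps _ _) (iterate_continuous n (Rmax 0 t)) (eps / 3))
    as [dl [hdl H]]; [lra|].
  exists (Rmin 1 dl); split; [apply Rmin_glb_lt; lra|]; intros s hs.
  assert (hs1 : Rabs (s - t) < 1) by (eapply Rlt_le_trans; [exact hs | apply Rmin_l]).
  assert (hs2 : Rabs (s - t) < dl) by (eapply Rlt_le_trans; [exact hs | apply Rmin_r]).
  assert (hst : Rabs (Rmax 0 s - Rmax 0 t) <= Rabs (s - t)).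
  { unfold Rmax; repeat destruct Rle_dec; unfold Rabs; repeat destruct Rcase_abs; lra. }
  assert (bnd : forall x, 0 <= x <= T -> Rabs (u x - iterate n x) < eps / 3).
  { intros x hx; eapply Rle_lt_trans; [apply uapprox, hx|].
    eapply Rle_lt_trans; [|exact hn].
    assert (exp (4 * C * x) <= exp (4 * C * T)).
    { destruct (Rle_lt_or_eq_dec x T) as [h | ->]; [lra| |lra].
      apply Rlt_le, exp_increasing; nra. }
    assert (H1 := pow_le (/ 2) n).
    replace (2 * A * exp (4 * C * T) * (/ 2) ^ n)
      with (2 * A * (/ 2) ^ n * exp (4 * C * T)) by ring.
    apply Rmult_le_compat_l; [apply Rmult_le_pos; lra | exact H0]. }
  rewrite (uneg s), (uneg t).
  specialize (H (Rmax 0 s)).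
  assert (Hs := bnd (Rmax 0 s)); assert (Ht := bnd (Rmax 0 t)).
  assert (h0s := Rmax_l 0 s); assert (h0t := Rmax_l 0 t).
  assert (hsT : Rmax 0 s <= T).
  { assert (Hm : Rabs (Rmax 0 s - Rmax 0 t) < 1) by lra.
    apply Rabs_def2 in Hm; unfold T; lra. }
  specialize (Hs (conj h0s hsT)).
  assert (htT : Rmax 0 t <= T) by (unfold T; lra).
  specialize (Ht (conj h0t htT)).
  specialize (H (Rle_lt_trans _ _ _ hst hs2)).
  apply Rabs_def2 in H; apply Rabs_def2 in Hs; apply Rabs_def2 in Ht.
  apply Rabs_def1; lra. }
(* Both [u] and [picard u] are within a multiple of [(/ 2) ^ n] of [iterate (S n)], the second one
   by the contraction. *)
assert (fixed : forall t, 0 <= t -> picard u t = u t).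
{ intros t ht; apply Rminus_diag_uniq.
  destruct (Req_dec (picard u t - u t) 0) as [h | h]; [exact h | exfalso].
  apply Rabs_pos_lt in h.
  destruct (small (2 * A * exp (4 * C * t)) _ h) as [n hn].
  assert (H1 := uapprox (S n) t ht).
  assert (H2 := picard_contraction u (iterate n) (2 * A * (/ 2) ^ n) ucont
    (iterate_continuous n) (uapprox n) t ht).
  change (picard (iterate n) t) with (iterate (S n) t) in H2.
  simpl pow in H1.
  assert (H3 : Rabs (picard u t - u t)
    <= Rabs (picard u t - iterate (S n) t) + Rabs (u t - iterate (S n) t)).
  { replace (picard u t - u t)
      with ((picard u t - iterate (S n) t) + - (u t - iterate (S n) t)) by ring.
    eapply Rle_trans; [apply Rabs_triang|]; rewrite Rabs_Ropp; lra. }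
  lra. }
(* The witness is [picard u] rather than the equal function [u]: being a primitive, it comes with
   its derivative. *)
exists (picard u), (picard_aux u).
refine (conj _ (conj _ (conj _ (conj _ (conj _ _))))).
- apply picard_continuous, ucont.
- intros t; eapply is_derive_continuity_pt, picard_aux_derive, ucont.
- apply picard_0.
- apply picard_aux_0.
- intros t ht; rewrite fixed by lra; apply picard_derive, ucont.
- intros t ht; rewrite fixed by lra; apply picard_aux_derive, ucont.
Qed.

End Picard.

(** * Planar systems and the nonlinearity *)

(** The bound on [Rabs (dD t)] makes [D * exp (k t)] nondecreasing and [D * exp (- k t)]
    nonincreasing; [mono] treats both through the sign [e]. Hence the estimate holds in both time
    directions, and data may be prescribed at any point, endpoints included. *)
Lemma gronwall (D dD : R -> R) (a b k : R) :
  (forall t, a < t < b -> is_derive D t (dD t)) ->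
  (forall t, a <= t <= b -> continuity_pt D t) ->
  (forall t, a < t < b -> Rabs (dD t) <= k * D t) ->
  forall x y, a <= x <= b -> a <= y <= b -> D x <= D y * exp (k * Rabs (x - y)).
Proof.
intros hd hc hk x y hx hy.
assert (mono : forall e s t, Rabs e = 1 -> a <= s -> s <= t -> t <= b ->
  e * (D t * exp (e * k * t)) >= e * (D s * exp (e * k * s))).
{ intros e s t he hs hst ht.
  set (g := fun r => - (e * (D r * exp (e * k * r)))).
  assert (H : g t - g s <= 0 * (t - s)).
  { apply increment_le with
      (df := fun r => - (e * (dD r * exp (e * k * r) + D r * (e * k * exp (e * k * r))))).
    - exact hst.
    - intros r hr; unfold g.
      apply (is_derive_opp (fun r => e * (D r * exp (e * k * r)))).
      apply (is_derive_scal (fun r => D r * exp (e * k * r))).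
      apply (is_derive_mult D (fun r => exp (e * k * r))); [apply hd; lra | |intros; apply Rmult_comm].
      auto_derive; [exact I | ring].
    - intros r hr; unfold g; apply continuity_pt_opp, continuity_pt_scal, continuity_pt_mult.
      + apply hc; lra.
      + apply (is_derive_continuity_pt _ _ (e * k * exp (e * k * r))); auto_derive; [exact I | ring].
    - intros r hr.
      assert (h1 : Rabs (dD r) <= k * D r) by (apply hk; lra).
      assert (h2 := exp_pos (e * k * r)).
      assert (h3 : - (e * dD r) <= Rabs (dD r)).
      { rewrite <- Rabs_Ropp, <- (Rmult_1_l (Rabs (- dD r))), <- he, <- Rabs_mult.
        replace (- (e * dD r)) with (e * - dD r) by ring; apply Rle_abs. }
      assert (h4 : e * e = 1).
      { unfold Rabs in he; destruct Rcase_abs; [replace e with (-1) by lra | replace e with 1 by lra]; ring. }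
      replace (- (e * (dD r * exp (e * k * r) + D r * (e * k * exp (e * k * r)))))
        with (exp (e * k * r) * (- (e * dD r) - e * e * k * D r)) by ring.
      rewrite h4; assert (- (e * dD r) - 1 * k * D r <= 0) by lra; nra. }
  unfold g in H; lra. }
destruct (Rle_lt_dec x y) as [hxy | hxy].
- rewrite Rabs_left1 by lra.
  assert (H := mono 1 x y Rabs_R1 (proj1 hx) hxy (proj2 hy)).
  assert (he := exp_pos (- (k * x))).
  replace (k * - (x - y)) with (1 * k * y + - (k * x)) by ring.
  rewrite exp_plus.
  assert (E : exp (1 * k * x) * exp (- (k * x)) = 1).
  { rewrite <- exp_plus; replace (_ + _) with 0 by ring; apply exp_0. }
  assert (H' : D x * exp (1 * k * x) * exp (- (k * x)) <= D y * exp (1 * k * y) * exp (- (k * x)))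
    by (apply Rmult_le_compat_r; lra).
  rewrite Rmult_assoc, E in H'; lra.
- rewrite Rabs_pos_eq by lra.
  assert (h1 : Rabs (-1) = 1) by (rewrite Rabs_left; lra).
  assert (H := mono (-1) y x h1 (proj1 hy) (Rlt_le _ _ hxy) (proj2 hx)).
  assert (he := exp_pos (k * x)).
  replace (k * (x - y)) with (-1 * k * y + k * x) by ring.
  rewrite exp_plus.
  assert (E : exp (-1 * k * x) * exp (k * x) = 1).
  { rewrite <- exp_plus; replace (_ + _) with 0 by ring; apply exp_0. }
  assert (H' : D x * exp (-1 * k * x) * exp (k * x) <= D y * exp (-1 * k * y) * exp (k * x))
    by (apply Rmult_le_compat_r; lra).
  rewrite Rmult_assoc, E in H'; lra.
Qed.

Definition planar_solution (c d : R -> R) (a b : R) (u z : R -> R) : Prop :=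
  (forall t, a <= t <= b -> continuity_pt u t) /\
  (forall t, a <= t <= b -> continuity_pt z t) /\
  (forall t, a < t < b -> is_derive u t (z t + c (u t))) /\
  (forall t, a < t < b -> is_derive z t (- d (u t))).

(** Gronwall for the squared distance. Its derivative is at most [2 |x||y| + 2 C x^2 + 2 C |x||y|]
    for the differences [x] of [u] and [y] of [z], and this is at most [4 C (x^2 + y^2)] because
    [1 <= C]. *)
Lemma planar_dependence (c d : R -> R) (C a b : R) (u1 z1 u2 z2 : R -> R) :
  1 <= C ->
  (forall x y, Rabs (c x - c y) <= C * Rabs (x - y)) ->
  (forall x y, Rabs (d x - d y) <= C * Rabs (x - y)) ->
  planar_solution c d a b u1 z1 -> planar_solution c d a b u2 z2 ->
  forall x y, a <= x <= b -> a <= y <= b ->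
    (u1 x - u2 x) ^ 2 + (z1 x - z2 x) ^ 2
    <= ((u1 y - u2 y) ^ 2 + (z1 y - z2 y) ^ 2) * exp (4 * C * Rabs (x - y)).
Proof.
intros hC hc hd [cu1 [cz1 [du1 dz1]]] [cu2 [cz2 [du2 dz2]]].
apply (gronwall (fun t => (u1 t - u2 t) ^ 2 + (z1 t - z2 t) ^ 2)
  (fun t => 2 * (u1 t - u2 t) * ((z1 t + c (u1 t)) - (z2 t + c (u2 t)))
          + 2 * (z1 t - z2 t) * (- d (u1 t) - - d (u2 t)))).
- intros t ht.
  specialize (du1 t ht); specialize (dz1 t ht); specialize (du2 t ht); specialize (dz2 t ht).
  assert (hu := is_derive_minus _ _ _ _ _ du1 du2); assert (hz := is_derive_minus _ _ _ _ _ dz1 dz2).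
  apply (is_derive_plus (fun t => (u1 t - u2 t) ^ 2)).
  + assert (H := is_derive_pow _ 2 _ _ hu); simpl INR in H; simpl Init.Nat.pred in H.
    rewrite pow_1 in H; eapply is_derive_ext_loc; [|unfold minus, plus, opp in H; simpl in H;
      replace (2 * (u1 t - u2 t) * ((z1 t + c (u1 t)) - (z2 t + c (u2 t)))) with
      ((1 + 1) * (z1 t + c (u1 t) + - (z2 t + c (u2 t))) * (u1 t + - u2 t)) by ring; exact H].
    apply filter_forall; intros s; reflexivity.
  + assert (H := is_derive_pow _ 2 _ _ hz); simpl INR in H; simpl Init.Nat.pred in H.
    rewrite pow_1 in H; eapply is_derive_ext_loc; [|unfold minus, plus, opp in H; simpl in H;
      replace (2 * (z1 t - z2 t) * (- d (u1 t) - - d (u2 t))) with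
      ((1 + 1) * (- d (u1 t) + - - d (u2 t)) * (z1 t + - z2 t)) by ring; exact H].
    apply filter_forall; intros s; reflexivity.
- intros t ht.
  apply continuity_pt_plus; simpl; repeat apply continuity_pt_mult;
    try (apply continuity_pt_const; intros ? ?; reflexivity);
    apply continuity_pt_minus; auto.
- intros t _.
  specialize (hc (u1 t) (u2 t)); specialize (hd (u1 t) (u2 t)).
  set (x := u1 t - u2 t) in *; set (y := z1 t - z2 t).
  set (s := c (u1 t) - c (u2 t)) in *; set (r := d (u1 t) - d (u2 t)) in *.
  replace (2 * x * (z1 t + c (u1 t) - (z2 t + c (u2 t))) + 2 * y * (- d (u1 t) - - d (u2 t)))
    with (2 * x * y + 2 * x * s - 2 * y * r) by (unfold y, s, r; ring).
  assert (hx : x ^ 2 = Rabs x * Rabs x) by (rewrite <- Rabs_mult, Rabs_pos_eq; nra).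
  assert (hy : y ^ 2 = Rabs y * Rabs y) by (rewrite <- Rabs_mult, Rabs_pos_eq; nra).
  rewrite hx, hy.
  assert (H : Rabs (2 * x * y + 2 * x * s - 2 * y * r)
    <= 2 * Rabs x * Rabs y + 2 * Rabs x * Rabs s + 2 * Rabs y * Rabs r).
  { eapply Rle_trans; [apply Rabs_triang|]; rewrite Rabs_Ropp.
    apply Rplus_le_compat.
    - eapply Rle_trans; [apply Rabs_triang|]; rewrite !Rabs_mult, (Rabs_pos_eq 2) by lra; lra.
    - rewrite !Rabs_mult, (Rabs_pos_eq 2) by lra; lra. }
  assert (px := Rabs_pos x); assert (py := Rabs_pos y).
  assert (Rabs x * Rabs s <= Rabs x * (C * Rabs x)) by (apply Rmult_le_compat_l; lra).
  assert (Rabs y * Rabs r <= Rabs y * (C * Rabs x)) by (apply Rmult_le_compat_l; lra).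
  assert (0 <= (Rabs x - Rabs y) ^ 2) by apply pow2_ge_0.
  assert (0 <= C * (Rabs x - Rabs y) ^ 2) by (apply Rmult_le_pos; lra).
  nra.
Qed.

Lemma planar_unique (c d : R -> R) (C a b : R) (u1 z1 u2 z2 : R -> R) (y : R) :
  1 <= C ->
  (forall x y, Rabs (c x - c y) <= C * Rabs (x - y)) ->
  (forall x y, Rabs (d x - d y) <= C * Rabs (x - y)) ->
  planar_solution c d a b u1 z1 -> planar_solution c d a b u2 z2 ->
  a <= y <= b -> u1 y = u2 y -> z1 y = z2 y ->
  forall x, a <= x <= b -> u1 x = u2 x /\ z1 x = z2 x.
Proof.
intros hC hc hd h1 h2 hy eu ez x hx.
assert (H := planar_dependence c d C a b u1 z1 u2 z2 hC hc hd h1 h2 x y hx hy).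
rewrite eu, ez in H.
replace ((u2 y - u2 y) ^ 2 + (z2 y - z2 y) ^ 2) with 0 in H by ring.
rewrite Rmult_0_l in H.
assert (hu := pow2_ge_0 (u1 x - u2 x)); assert (hz := pow2_ge_0 (z1 x - z2 x)).
split; apply Rminus_diag_uniq, Rsqr_0_uniq; unfold Rsqr; lra.
Qed.

(** * The power nonlinearity and its truncation *)

Lemma Rpower_ge_square (q u : R) : 2 <= q -> 0 < u -> u ^ 2 - 1 <= Rpower u q.
Proof.
intros hq hu; destruct (Rle_lt_dec 1 u) as [h | h].
- assert (Rpower u 2 <= Rpower u q) by (apply Rle_Rpower; lra).
  replace 2 with (INR 2) in H by (simpl; ring).
  rewrite Rpower_pow in H by exact hu; lra.
- assert (0 < Rpower u q) by apply exp_pos; nra.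
Qed.

Lemma is_derive_Rpower (q x : R) :
  0 < x -> is_derive (fun x => Rpower x q) x (q * Rpower x (q - 1)).
Proof. intros hx; apply is_derive_Reals, derivable_pt_lim_power, hx. Qed.

Definition nonlinearity (p lambda u : R) : R :=
  u * Rpower (Rabs u) (p - 1) - lambda * u.

Lemma nonlinearity_pos (p lambda u : R) :
  0 < u -> nonlinearity p lambda u = u * (Rpower u (p - 1) - lambda).
Proof. intros hu; unfold nonlinearity; rewrite Rabs_pos_eq by lra; ring. Qed.

(** [A] bounds the power on the interval and [B] its derivative, both being largest at [K] since the
    exponents are nonnegative. *)
Lemma nonlinearity_lipschitz (p lambda K : R) :
  3 <= p -> 0 < lambda -> 0 < K ->
  exists C, 0 <= C /\ forall x y, 0 <= x <= K -> 0 <= y <= K ->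
    Rabs (nonlinearity p lambda x - nonlinearity p lambda y) <= C * Rabs (x - y).
Proof.
intros hp hl hK.
set (A := Rpower K (p - 1)); set (B := (p - 1) * Rpower K (p - 1 - 1)).
assert (hA : 0 < A) by apply exp_pos.
assert (hB : 0 < B) by (apply Rmult_lt_0_compat; [lra | apply exp_pos]).
exists (A + K * B + lambda); split; [nra|].
assert (key : forall x y, 0 <= x <= y -> y <= K ->
  Rabs (nonlinearity p lambda x - nonlinearity p lambda y) <= (A + K * B + lambda) * Rabs (x - y)).
{ intros x y hx hy.
  destruct (Req_dec x y) as [-> | hne].
  { rewrite !Rminus_diag, !Rabs_R0; lra. }
  assert (hxy : x < y) by lra.
  assert (hpy : 0 < Rpower y (p - 1) <= A).
  { split; [apply exp_pos | apply Rle_Rpower_l; lra]. }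
  (* [D] is [x] times the increment of the power, estimated by the mean value theorem. At [x = 0],
     where [Rpower] has a default value, the factor [x] kills this term and [D = 0]. *)
  assert (inc : exists D, 0 <= D <= K * B * (y - x) /\
    nonlinearity p lambda y - nonlinearity p lambda x
      = (y - x) * Rpower y (p - 1) + D - lambda * (y - x)).
  { destruct (proj1 hx) as [hx0 | <-].
    - destruct (mvt_open (fun x => Rpower x (p - 1)) (fun x => (p - 1) * Rpower x (p - 1 - 1)) x y)
        as [c [hc e]]; [lra | | |].
      + intros; apply is_derive_Rpower; lra.
      + intros; eapply is_derive_continuity_pt, is_derive_Rpower; lra.
      + assert (hr : 0 < Rpower c (p - 1 - 1)) by apply exp_pos.
        assert (hcB : (p - 1) * Rpower c (p - 1 - 1) <= B)
          by (apply Rmult_le_compat_l; [lra | apply Rle_Rpower_l; lra]).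
        exists (x * (Rpower y (p - 1) - Rpower x (p - 1))); split.
        * rewrite e; split.
          -- repeat apply Rmult_le_pos; lra.
          -- rewrite <- Rmult_assoc; apply Rmult_le_compat_r; [lra|].
             apply Rmult_le_compat; try lra; apply Rmult_le_pos; lra.
        * rewrite !nonlinearity_pos by lra; ring.
    - exists 0; split; [split; [lra | apply Rmult_le_pos; [apply Rmult_le_pos|]; lra]|].
      rewrite nonlinearity_pos by lra; unfold nonlinearity; ring. }
  destruct inc as [D [hD e]].
  rewrite Rabs_minus_sym, e, (Rabs_left1 (x - y)) by lra.
  apply Rabs_le; split; nra. }
intros x y hx hy; destruct (Rle_lt_dec x y) as [h | h]; [apply key; lra|].
rewrite Rabs_minus_sym, (Rabs_minus_sym x); apply key; lra.
Qed.

(* Writing the equation in [u] and [z = v - sigma u^2 / 2], it suffices to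
   truncate [u] to obtain a globally Lipschitz system. *)
Definition trunc_quad (sigma K u : R) : R := sigma / 2 * clamp 0 K u ^ 2.
Definition trunc_nl (p lambda K u : R) : R := nonlinearity p lambda (clamp 0 K u).

Lemma trunc_lipschitz (p lambda sigma K : R) :
  3 <= p -> 0 < lambda -> -1 <= sigma <= 1 -> 0 < K ->
  exists C, 1 <= C /\
    (forall x y, Rabs (trunc_quad sigma K x - trunc_quad sigma K y) <= C * Rabs (x - y)) /\
    (forall x y, Rabs (trunc_nl p lambda K x - trunc_nl p lambda K y) <= C * Rabs (x - y)).
Proof.
intros hp hl hs hK.
destruct (nonlinearity_lipschitz p lambda K hp hl hK) as [C [hC H]].
exists (1 + C + K); split; [lra|]; split; intros x y;
  assert (hx := clamp_bounds 0 K x (Rlt_le _ _ hK));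
  assert (hy := clamp_bounds 0 K y (Rlt_le _ _ hK));
  assert (hxy := clamp_lipschitz 0 K x y); assert (h0 := Rabs_pos (x - y)).
- unfold trunc_quad.
  replace (sigma / 2 * clamp 0 K x ^ 2 - sigma / 2 * clamp 0 K y ^ 2)
    with (sigma * ((clamp 0 K x + clamp 0 K y) / 2) * (clamp 0 K x - clamp 0 K y)) by field.
  rewrite 2!Rabs_mult, (Rabs_pos_eq (_ / 2)) by lra.
  assert (Rabs sigma <= 1) by (apply Rabs_le; lra).
  assert (hs0 := Rabs_pos sigma).
  apply Rmult_le_compat; [apply Rmult_le_pos; lra | apply Rabs_pos | | exact hxy].
  nra.
- unfold trunc_nl; eapply Rle_trans; [apply H; assumption|].
  apply Rmult_le_compat; try lra; apply Rabs_pos.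
Qed.

(** * Positive solutions and their logarithmic slope *)

Lemma lipschitz_of_derive (f df : R -> R) (a b K : R) :
  (forall x, a < x < b -> is_derive f x (df x)) ->
  (forall x, a <= x <= b -> continuity_pt f x) ->
  (forall x, a < x < b -> Rabs (df x) <= K) ->
  forall s t, a <= s <= b -> a <= t <= b -> Rabs (f s - f t) <= K * Rabs (s - t).
Proof.
intros hd hc hK.
assert (key : forall s t, a <= s -> s <= t -> t <= b -> Rabs (f s - f t) <= K * Rabs (s - t)).
{ intros s t hs hst ht.
  rewrite Rabs_minus_sym, (Rabs_left1 (s - t)) by lra.
  replace (- (s - t)) with (t - s) by ring.
  apply increment_Rabs_le with df; [exact hst | | |]; intros x hx;
    [apply hd | apply hc | apply hK]; lra. }
intros s t hs ht; destruct (Rle_lt_dec s t) as [h | h]; [apply key; lra|].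
rewrite Rabs_minus_sym, (Rabs_minus_sym s); apply key; lra.
Qed.

Lemma zero_between (f : R -> R) (a b s t : R) :
  a <= s <= b -> a <= t <= b -> (forall x, a <= x <= b -> continuity_pt f x) ->
  f s < 0 -> 0 < f t -> exists c, Rmin s t < c < Rmax s t /\ f c = 0.
Proof.
intros hs ht hc fs ft.
destruct (Rtotal_order s t) as [h | [-> | h]]; [| lra |].
- rewrite Rmin_left, Rmax_right by lra.
  destruct (first_hit f s t 0) as [c [hcst [e _]]]; [lra | | lra |].
  + intros x hx; apply hc; lra.
  + exists c; split; [|exact e]; split; [lra|].
    destruct (proj2 hcst) as [? | ->]; lra.
- rewrite Rmin_right, Rmax_left by lra.
  destruct (first_hit (fun x => - f x) t s 0) as [c [hcst [e _]]]; [lra | | lra |].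
  + intros x hx; apply continuity_pt_opp, hc; lra.
  + exists c; split; [|lra]; split; [lra|].
    destruct (proj2 hcst) as [? | ->]; lra.
Qed.

(* [sigma = 1] is the equation of the theorem; [sigma = -1] is its image under
   the reflection [t |-> - t]. *)
Definition solves (p lambda sigma a b : R) (u v : R -> R) : Prop :=
  (forall t, a <= t <= b -> continuity_pt u t) /\
  (forall t, a <= t <= b -> continuity_pt v t) /\
  (forall t, a < t < b -> is_derive u t (v t)) /\
  (forall t, a < t < b -> is_derive v t (sigma * u t * v t - nonlinearity p lambda (u t))).

Section Equation.
Variables (p lambda : R).
Hypothesis (hp : 3 <= p) (hl : 0 < lambda).

Lemma solves_restrict (sigma a b a' b' : R) (u v : R -> R) :
  solves p lambda sigma a b u v -> a <= a' -> b' <= b -> solves p lambda sigma a' b' u v.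
Proof.
intros [h1 [h2 [h3 h4]]] ha hb.
refine (conj _ (conj _ (conj _ _))); intros t ht; [apply h1 | apply h2 | apply h3 | apply h4]; lra.
Qed.

Definition log_slope_derivative (sigma : R) (u v : R -> R) (t : R) : R :=
  sigma * v t - (Rpower (u t) (p - 1) - lambda) - (v t / u t) ^ 2.

Lemma log_slope_derive (sigma a b : R) (u v : R -> R) :
  solves p lambda sigma a b u v -> (forall t, a <= t <= b -> 0 < u t) ->
  (forall t, a < t < b -> is_derive (fun t => v t / u t) t (log_slope_derivative sigma u v t)) /\
  (forall t, a <= t <= b -> continuity_pt (fun t => v t / u t) t).
Proof.
intros [h1 [h2 [h3 h4]]] hu; split; intros t ht.
- assert (hut : 0 < u t) by (apply hu; lra).
  assert (H := is_derive_div v u t _ _ (h4 t ht) (h3 t ht)).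
  unfold log_slope_derivative.
  replace (sigma * v t - (Rpower (u t) (p - 1) - lambda) - (v t / u t) ^ 2)
    with (((sigma * u t * v t - nonlinearity p lambda (u t)) * u t - v t * v t) / (u t) ^ 2).
  + apply H; lra.
  + rewrite nonlinearity_pos by exact hut; field; lra.
- apply (continuity_pt_div v u); auto.
  assert (0 < u t) by auto; lra.
Qed.

Lemma log_derive (sigma a b : R) (u v : R -> R) :
  solves p lambda sigma a b u v -> (forall t, a <= t <= b -> 0 < u t) ->
  (forall t, a < t < b -> is_derive (fun t => ln (u t)) t (v t / u t)) /\
  (forall t, a <= t <= b -> continuity_pt (fun t => ln (u t)) t).
Proof.
intros [h1 [h2 [h3 h4]]] hu; split; intros t ht.
- apply (is_derive_comp ln u t (/ u t) (v t)); [|apply h3, ht].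
  apply is_derive_ln, hu; lra.
- apply (continuity_pt_comp u ln); [auto|].
  eapply is_derive_continuity_pt, is_derive_ln, hu, ht.
Qed.

(* [p >= 3] enters through [u^(p-1) >= u^2 - 1]; the form [r^2 - u r + u^2] of
   the remaining terms is positive definite. *)
Lemma log_slope_derivative_le (sigma : R) (u v : R -> R) (t : R) :
  -1 <= sigma <= 1 -> 0 < u t ->
  log_slope_derivative sigma u v t <= (1 + lambda) - (u t ^ 2 + (v t / u t) ^ 2) / 2.
Proof.
intros hs hu; unfold log_slope_derivative.
assert (H := Rpower_ge_square (p - 1) (u t)).
assert (Hq : u t ^ 2 - 1 <= Rpower (u t) (p - 1)) by (apply H; lra).
set (r := v t / u t).
assert (e : v t = u t * r) by (unfold r; field; lra).
rewrite e.
assert (sigma * (u t * r) <= (u t ^ 2 + r ^ 2) / 2); [|lra].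
assert (h1 := pow2_ge_0 (u t - r)); assert (h2 := pow2_ge_0 (u t + r)).
assert (0 <= (1 - sigma) * (u t + r) ^ 2) by (apply Rmult_le_pos; lra).
assert (0 <= (1 + sigma) * (u t - r) ^ 2) by (apply Rmult_le_pos; lra).
nra.
Qed.

(** A one-sided bound on the derivative of the slope, but usable both ways: it bounds the slope
    above after a point where it is known, and below before such a point. *)
Lemma log_slope_le (sigma a b : R) (u v : R -> R) (s t : R) :
  -1 <= sigma <= 1 -> solves p lambda sigma a b u v -> (forall t, a <= t <= b -> 0 < u t) ->
  a <= s -> s <= t -> t <= b -> v t / u t <= v s / u s + (1 + lambda) * (t - s).
Proof.
intros hs hsol hu h1 h2 h3.
destruct (log_slope_derive sigma a b u v hsol hu) as [hd hc].
assert (H : v t / u t - v s / u s <= (1 + lambda) * (t - s)); [|lra].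
apply (increment_le (fun t => v t / u t) (log_slope_derivative sigma u v)); auto.
- intros x hx; apply hd; lra.
- intros x hx; apply hc; lra.
- intros x hx; eapply Rle_trans; [apply log_slope_derivative_le; [exact hs | apply hu; lra]|].
  assert (h4 := pow2_ge_0 (u x)); assert (h5 := pow2_ge_0 (v x / u x)); lra.
Qed.

(* Rolle's theorem for the slope [r] gives a point with [r' = 0], where [u] is
   bounded and [u^(p-1) - lambda] is controlled by [sup |r|]; hence so are
   [u^(p-1) - lambda] and [r'] everywhere, and [sup |r|] is at most a constant
   times the length times itself. *)
Lemma neumann_rigidity :
  exists l, 0 < l /\ forall (sigma a b : R) (u v : R -> R),
    -1 <= sigma <= 1 -> a < b -> b - a <= l -> solves p lambda sigma a b u v ->
    (forall t, a <= t <= b -> 0 < u t) -> v a = 0 -> v b = 0 ->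
    forall t, a <= t <= b -> v t = 0 /\ Rpower (u t) (p - 1) = lambda.
Proof.
(* For lengths at most [1], [L] bounds the slope [r], and [K] bounds [u]: it is the bound
   [sqrt (2 L)] at the Rolle point times the largest growth [exp L]. [Q] bounds the variation of
   [u^(p-1)] per unit of [sup |r|], and [C] does so for [r']. *)
set (L := 1 + lambda); set (K := sqrt (2 * L) * exp L).
set (Q := (p - 1) * Rpower K (p - 1)); set (C := 2 * (K + L) + Q).
assert (hL : 1 < L) by (unfold L; lra).
assert (hK : 0 < K) by (apply Rmult_lt_0_compat; [apply sqrt_lt_R0; lra | apply exp_pos]).
assert (hQ : 0 < Q) by (apply Rmult_lt_0_compat; [lra | apply exp_pos]).
assert (hC : 0 < C) by (unfold C; lra).
exists (Rmin 1 (/ (2 * C))); split.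
{ apply Rmin_glb_lt; [lra | apply Rinv_0_lt_compat; lra]. }
intros sigma a b u v hs hab hlen hsol hu va vb.
assert (hlen1 : b - a <= 1) by (eapply Rle_trans; [exact hlen | apply Rmin_l]).
assert (hlen2 : b - a <= / (2 * C)) by (eapply Rle_trans; [exact hlen | apply Rmin_r]).
destruct (log_slope_derive sigma a b u v hsol hu) as [rd rc].
destruct (log_derive sigma a b u v hsol hu) as [ld lc].
set (r := fun t => v t / u t) in *.
assert (ra : r a = 0) by (unfold r; rewrite va; unfold Rdiv; ring).
assert (rb : r b = 0) by (unfold r; rewrite vb; unfold Rdiv; ring).
(* The slope vanishes at both ends: the right end gives the lower bound and the left end the upper
   one. *)
assert (rL : forall t, a <= t <= b -> Rabs (r t) <= L).
{ intros t ht; apply Rabs_le; split.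
  - assert (H := log_slope_le sigma a b u v t b hs hsol hu (proj1 ht) (proj2 ht) (Rle_refl b)).
    fold (r t) (r b) L in H; rewrite rb in H; nra.
  - assert (H := log_slope_le sigma a b u v a t hs hsol hu (Rle_refl a) (proj1 ht) (proj2 ht)).
    fold (r t) (r a) L in H; rewrite ra in H; nra. }
destruct (mvt_open r (log_slope_derivative sigma u v) a b hab rd rc) as [x0 [hx0 e0]].
assert (d0 : log_slope_derivative sigma u v x0 = 0).
{ apply Rmult_eq_reg_r with (b - a); lra. }
assert (ux0 : 0 < u x0) by (apply hu; lra).
assert (ux0K : u x0 <= sqrt (2 * L)).
{ assert (H := log_slope_derivative_le sigma u v x0 hs ux0); rewrite d0 in H; fold L in H.
  assert (h2 := pow2_ge_0 (v x0 / u x0)).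
  rewrite <- (sqrt_pow2 (u x0)) by lra; apply sqrt_le_1_alt; lra. }
assert (uK : forall t, a <= t <= b -> u t <= K).
{ intros t ht.
  assert (H : Rabs (ln (u t) - ln (u x0)) <= L * Rabs (t - x0)).
  { apply (lipschitz_of_derive (fun t => ln (u t)) r a b); auto; [|lra].
    intros; apply rL; lra. }
  assert (Rabs (t - x0) <= 1) by (apply Rabs_le; lra).
  assert (H1 := Rle_abs (ln (u t) - ln (u x0))).
  assert (H2 : ln (u t) <= ln (u x0) + L) by nra.
  assert (hut : 0 < u t) by auto.
  destruct H2 as [H2 | H2].
  - apply exp_increasing in H2; rewrite exp_plus, !exp_ln in H2 by assumption.
    assert (u x0 * exp L <= K); [|lra].
    apply Rmult_le_compat_r; [apply Rlt_le, exp_pos | exact ux0K].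
  - apply (f_equal exp) in H2; rewrite exp_plus, !exp_ln in H2 by assumption.
    rewrite H2; apply Rmult_le_compat_r; [apply Rlt_le, exp_pos | exact ux0K]. }
destruct (continuity_ab_maj (fun t => Rabs (r t)) a b) as [x1 [hmax hx1]]; [lra | |].
{ intros c hc; apply (continuity_pt_comp r Rabs); [apply rc, hc | apply Rcontinuity_abs]. }
set (e := Rabs (r x1)) in *.
assert (he : 0 <= e) by apply Rabs_pos.
assert (heL : e <= L) by (apply rL, hx1).
assert (powLip : forall t, a <= t <= b ->
  Rabs (Rpower (u t) (p - 1) - Rpower (u x0) (p - 1)) <= Q * e * Rabs (t - x0)).
{ intros t ht.
  apply (lipschitz_of_derive (fun t => Rpower (u t) (p - 1))
    (fun t => (p - 1) * Rpower (u t) (p - 1) * r t) a b); auto; [| | |lra].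
  - intros x hx; specialize (ld x hx).
    assert (H := is_derive_comp exp _ x _ _ (is_derive_exp _) (is_derive_scal _ x (p - 1) _ ld)).
    unfold Rpower; replace ((p - 1) * exp ((p - 1) * ln (u x)) * r x)
      with (scal ((p - 1) * (v x / u x)) (exp ((p - 1) * ln (u x)))); [exact H|].
    unfold scal; simpl; unfold mult; simpl; unfold r; ring.
  - intros x hx; unfold Rpower.
    apply (continuity_pt_comp (fun x => (p - 1) * ln (u x)) exp).
    + apply continuity_pt_scal, lc, hx.
    + apply derivable_continuous_pt, derivable_pt_exp.
  - intros x hx; assert (hx' : a <= x <= b) by lra.
    assert (hpos : 0 < Rpower (u x) (p - 1)) by apply exp_pos.
    rewrite 2!Rabs_mult, (Rabs_pos_eq (p - 1)), (Rabs_pos_eq (Rpower _ _)) by lra.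
    apply Rmult_le_compat; [apply Rmult_le_pos; lra | apply Rabs_pos | | auto].
    apply Rmult_le_compat_l; [lra|].
    apply Rle_Rpower_l; [lra | split; auto]. }
(* [r'(t)] is compared with [r'(x0) = 0]. The terms containing [r] are at most [(K + L) * e] at each
   of the two points, and the powers differ by at most [Q * e]. *)
assert (rdC : forall t, a < t < b -> Rabs (log_slope_derivative sigma u v t) <= C * e).
{ intros t ht; assert (ht' : a <= t <= b) by lra.
  assert (small : forall x, a <= x <= b -> Rabs (sigma * v x - (v x / u x) ^ 2) <= (K + L) * e).
  { intros x hx; fold (r x).
    assert (hux : 0 < u x) by auto.
    replace (v x) with (u x * r x) by (unfold r; field; lra).
    replace (sigma * (u x * r x) - r x ^ 2) with ((sigma * u x - r x) * r x) by ring.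
    rewrite Rabs_mult.
    apply Rmult_le_compat; [apply Rabs_pos | apply Rabs_pos | | auto].
    specialize (rL x hx); specialize (uK x hx); apply Rcomplements.Rabs_le_between in rL.
    apply Rabs_le; split; nra. }
  assert (s1 := small t ht'); assert (s2 := small x0 ltac:(lra)).
  specialize (powLip t ht').
  assert (ht0 : Rabs (t - x0) <= 1) by (apply Rabs_le; lra).
  assert (powLip' : Rabs (Rpower (u t) (p - 1) - Rpower (u x0) (p - 1)) <= Q * e).
  { eapply Rle_trans; [exact powLip|].
    rewrite <- (Rmult_1_r (Q * e)) at 2; apply Rmult_le_compat_l; [apply Rmult_le_pos; lra | exact ht0]. }
  unfold log_slope_derivative in d0 |- *.
  apply Rcomplements.Rabs_le_between in s1; apply Rcomplements.Rabs_le_between in s2;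
    apply Rcomplements.Rabs_le_between in powLip'.
  apply Rabs_le; unfold C; split; lra. }
(* Since [r a = 0] and the length is at most [/ (2 * C)], the maximum [e] of [|r|] is at most
   [e / 2]. *)
assert (e0' : e = 0).
{ assert (H : Rabs (r x1 - r a) <= C * e * Rabs (x1 - a)).
  { apply (lipschitz_of_derive r (log_slope_derivative sigma u v) a b); auto; lra. }
  rewrite ra, Rminus_0_r, (Rabs_pos_eq (x1 - a)) in H by lra; fold e in H.
  assert (H1 : C * e * (x1 - a) <= C * e * / (2 * C)).
  { apply Rmult_le_compat_l; [apply Rmult_le_pos|]; lra. }
  replace (C * e * / (2 * C)) with (e / 2) in H1 by (field; lra); lra. }
assert (r0 : forall t, a <= t <= b -> r t = 0).
{ intros t ht; specialize (hmax t ht); rewrite e0' in hmax.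
  assert (H := Rabs_pos (r t)); apply Rabs_eq_0; lra. }
assert (v0 : forall t, a <= t <= b -> v t = 0).
{ intros t ht; specialize (r0 t ht); unfold r in r0; assert (hut : 0 < u t) by auto.
  replace (v t) with (u t * (v t / u t)) by (field; lra); rewrite r0; ring. }
intros t ht; split; [auto|].
specialize (powLip t ht); rewrite e0', Rmult_0_r, Rmult_0_l in powLip.
assert (H := Rabs_pos (Rpower (u t) (p - 1) - Rpower (u x0) (p - 1))).
assert (H1 : Rpower (u t) (p - 1) - Rpower (u x0) (p - 1) = 0) by (apply Rabs_eq_0; lra).
unfold log_slope_derivative in d0.
fold (r x0) in d0; rewrite r0, v0 in d0 by lra.
replace (0 ^ 2) with 0 in d0 by ring; lra.
Qed.

(** For [z = v - sigma / 2 * u^2] the product [u v] cancels: [z' = - nonlinearity p lambda u] and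
    [u' = z + sigma / 2 * u^2]. The right-hand sides are functions of [u] alone, up to the linear
    term [z], and truncation changes nothing while [u] stays in [[0, K]]. *)
Lemma solves_planar (sigma a b K : R) (u v : R -> R) :
  0 < K -> solves p lambda sigma a b u v -> (forall t, a <= t <= b -> 0 <= u t <= K) ->
  planar_solution (trunc_quad sigma K) (trunc_nl p lambda K) a b
    u (fun t => v t - sigma / 2 * u t ^ 2).
Proof.
intros hK [h1 [h2 [h3 h4]]] hu.
refine (conj h1 (conj _ (conj _ _))); intros t ht.
- apply continuity_pt_minus; [auto|]; apply continuity_pt_scal; simpl.
  repeat apply continuity_pt_mult; auto.
  apply continuity_pt_const; intros ? ?; reflexivity.
- unfold trunc_quad; rewrite clamp_id by (apply hu; lra).
  replace (v t - sigma / 2 * u t ^ 2 + sigma / 2 * u t ^ 2) with (v t) by ring; auto.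
- unfold trunc_nl; rewrite clamp_id by (apply hu; lra).
  replace (- nonlinearity p lambda (u t))
    with ((sigma * u t * v t - nonlinearity p lambda (u t)) - sigma / 2 * (INR 2 * v t * u t ^ 1))
    by (simpl; field).
  apply (is_derive_minus v); [auto|].
  apply (is_derive_scal (fun t => u t ^ 2)), (is_derive_pow u 2); auto.
Qed.

Lemma planar_solves (sigma a b K : R) (u z : R -> R) :
  planar_solution (trunc_quad sigma K) (trunc_nl p lambda K) a b u z ->
  (forall t, a <= t <= b -> 0 <= u t <= K) ->
  solves p lambda sigma a b u (fun t => z t + sigma / 2 * u t ^ 2).
Proof.
intros [h1 [h2 [h3 h4]]] hu.
assert (h3' : forall t, a < t < b -> is_derive u t (z t + sigma / 2 * u t ^ 2)).
{ intros t ht; specialize (h3 t ht); unfold trunc_quad in h3.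
  rewrite clamp_id in h3 by (apply hu; lra); exact h3. }
refine (conj h1 (conj _ (conj h3' _))); intros t ht.
- apply continuity_pt_plus; [auto|]; apply continuity_pt_scal; simpl.
  repeat apply continuity_pt_mult; auto.
  apply continuity_pt_const; intros ? ?; reflexivity.
- specialize (h4 t ht); unfold trunc_nl in h4; rewrite clamp_id in h4 by (apply hu; lra).
  replace (sigma * u t * (z t + sigma / 2 * u t ^ 2) - nonlinearity p lambda (u t))
    with (- nonlinearity p lambda (u t)
          + sigma / 2 * (INR 2 * (z t + sigma / 2 * u t ^ 2) * u t ^ 1)) by (simpl; field).
  apply (is_derive_plus z); [exact h4|].
  apply (is_derive_scal (fun t => u t ^ 2)), (is_derive_pow u 2); auto.
Qed.

(** Both solutions are bounded on the compact interval, hence solve one and the same truncated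
    Lipschitz system. *)
Lemma solves_unique (sigma a b : R) (u1 v1 u2 v2 : R -> R) (y : R) :
  -1 <= sigma <= 1 -> solves p lambda sigma a b u1 v1 -> solves p lambda sigma a b u2 v2 ->
  (forall t, a <= t <= b -> 0 <= u1 t) -> (forall t, a <= t <= b -> 0 <= u2 t) ->
  a <= y <= b -> u1 y = u2 y -> v1 y = v2 y ->
  forall t, a <= t <= b -> u1 t = u2 t /\ v1 t = v2 t.
Proof.
intros hs h1 h2 p1 p2 hy eu ev t ht.
destruct (continuity_ab_maj u1 a b) as [x1 [m1 _]]; [lra | apply h1|].
destruct (continuity_ab_maj u2 a b) as [x2 [m2 _]]; [lra | apply h2|].
set (K := 1 + Rmax (u1 x1) (u2 x2)).
assert (k1 := Rmax_l (u1 x1) (u2 x2)); assert (k2 := Rmax_r (u1 x1) (u2 x2)).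
assert (hK : 0 < K) by (specialize (p1 t ht); specialize (m1 t ht); unfold K; lra).
destruct (trunc_lipschitz p lambda sigma K hp hl hs hK) as [C [hC [hc hd]]].
assert (s1 : planar_solution (trunc_quad sigma K) (trunc_nl p lambda K) a b
    u1 (fun t => v1 t - sigma / 2 * u1 t ^ 2)).
{ apply solves_planar; [exact hK | exact h1|]; intros s hsab; specialize (m1 s hsab).
  split; [auto | unfold K; lra]. }
assert (s2 : planar_solution (trunc_quad sigma K) (trunc_nl p lambda K) a b
    u2 (fun t => v2 t - sigma / 2 * u2 t ^ 2)).
{ apply solves_planar; [exact hK | exact h2|]; intros s hsab; specialize (m2 s hsab).
  split; [auto | unfold K; lra]. }
destruct (planar_unique _ _ C a b _ _ _ _ y hC hc hd s1 s2 hy eu) with (x := t) as [e1 e2].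
- simpl; rewrite eu, ev; reflexivity.
- exact ht.
- simpl in e2; rewrite e1 in e2; split; [exact e1 | lra].
Qed.

Lemma constant_solves (sigma a b k : R) :
  nonlinearity p lambda k = 0 -> solves p lambda sigma a b (fun _ => k) (fun _ => 0).
Proof.
intros hk; refine (conj _ (conj _ (conj _ _))); intros t _.
- apply continuity_pt_const; intros ? ?; reflexivity.
- apply continuity_pt_const; intros ? ?; reflexivity.
- apply (is_derive_const k).
- rewrite hk, Rmult_0_r, Rminus_0_r; apply (is_derive_const 0).
Qed.

Lemma nonlinearity_0 : nonlinearity p lambda 0 = 0.
Proof. unfold nonlinearity; ring. Qed.

Lemma solves_nonneg (sigma a b : R) (u v : R -> R) :
  solves p lambda sigma a b u v -> (forall t, a < t < b -> 0 < u t) ->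
  a < b -> forall t, a <= t <= b -> 0 <= u t.
Proof.
intros [h1 _] hu hab t ht; apply Rnot_lt_le; intros hneg.
destruct (proj1 (continuity_pt_eps _ _) (h1 t ht) (- u t)) as [d [hd H]]; [lra|].
assert (ex : exists s, a < s < b /\ Rabs (s - t) < d).
{ assert (hm := Rmin_l d (b - a)); assert (hm' := Rmin_r d (b - a)).
  assert (hm0 : 0 < Rmin d (b - a)) by (apply Rmin_glb_lt; lra).
  destruct (Rle_lt_dec t ((a + b) / 2)).
  - exists (t + Rmin d (b - a) / 4); split; [|apply Rabs_def1]; lra.
  - exists (t - Rmin d (b - a) / 4); split; [|apply Rabs_def1]; lra. }
destruct ex as [s [hs hsd]].
specialize (H s hsd); specialize (hu s hs); apply Rabs_def2 in H; lra.
Qed.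

(** Otherwise [u] would coincide with the zero solution, against its positivity inside the
    interval. *)
Lemma solves_zero_slope (sigma a b : R) (u v : R -> R) (y : R) :
  -1 <= sigma <= 1 -> solves p lambda sigma a b u v -> (forall t, a < t < b -> 0 < u t) ->
  a < b -> a <= y <= b -> u y = 0 -> v y <> 0.
Proof.
intros hs h hu hab hy uy vy.
destruct (solves_unique sigma a b u v (fun _ => 0) (fun _ => 0) y hs h
  (constant_solves sigma a b 0 nonlinearity_0)) with (t := (a + b) / 2) as [e _];
  auto; [|intros; lra | lra|].
- apply (solves_nonneg sigma a b u v h hu hab).
- specialize (hu ((a + b) / 2)); lra.
Qed.

(** A descent from a peak of height [m] at time [0] to its first zero at time [L]. With [sigma = -1]
    it is the left side of a peak, read backwards. *)
Definition hits (sigma m L : R) (u v : R -> R) : Prop :=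
  0 < L /\ solves p lambda sigma 0 L u v /\ u 0 = m /\ v 0 = 0 /\
  (forall t, 0 <= t < L -> 0 < u t) /\ u L = 0.

(** If [v] vanished at some [t] inside, rigidity on [[0, t]] would make [m] the positive
    equilibrium; by uniqueness [u] would stay equal to [m] and never reach [0]. So [v] has constant
    sign, negative because [u] decreases from [m] to [0]. *)
Lemma hits_decreasing (l : R) :
  (forall (sigma a b : R) (u v : R -> R),
    -1 <= sigma <= 1 -> a < b -> b - a <= l -> solves p lambda sigma a b u v ->
    (forall t, a <= t <= b -> 0 < u t) -> v a = 0 -> v b = 0 ->
    forall t, a <= t <= b -> v t = 0 /\ Rpower (u t) (p - 1) = lambda) ->
  forall (sigma m L : R) (u v : R -> R),
    -1 <= sigma <= 1 -> L <= l -> hits sigma m L u v -> forall t, 0 < t < L -> v t < 0.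
Proof.
intros rigid sigma m L u v hs hLl [hL [hsol [um [v0 [hu uL]]]]].
assert (hm : 0 < m) by (rewrite <- um; apply hu; lra).
assert (vn : forall t, 0 < t < L -> v t <> 0).
{ intros t ht vt.
  destruct (rigid sigma 0 t u v hs) with (t := 0) as [_ e]; auto; try lra.
  - apply (solves_restrict sigma 0 L); [exact hsol | lra | lra].
  - intros s hst; apply hu; lra.
  - rewrite um in e.
    destruct (solves_unique sigma 0 L u v (fun _ => m) (fun _ => 0) 0 hs hsol) with (t := L)
      as [e' _]; auto; try lra; [| |intros; lra].
    + apply constant_solves; rewrite nonlinearity_pos by exact hm; rewrite e; ring.
    + apply (solves_nonneg sigma 0 L u v hsol); [intros; apply hu|]; lra. }
intros t ht; apply Rnot_le_lt; intros [hvt | hvt]; [|symmetry in hvt; exact (vn t ht hvt)].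
destruct hsol as [h1 [h2 [h3 h4]]].
destruct (mvt_open u v 0 L hL h3 h1) as [s [hs0 e]].
assert (hvs : v s < 0) by nra.
destruct (zero_between v 0 L s t) as [c [hc ec]]; auto; [lra | lra|].
apply (vn c); [|exact ec].
revert hc; apply Rmin_case; apply Rmax_case; lra.
Qed.

End Equation.

(** * Comparison and shooting *)

Lemma derive_pos_left (f : R -> R) (x l : R) :
  is_derive f x l -> 0 < l ->
  exists d, 0 < d /\ forall h, 0 < h < d -> f (x - h) < f x.
Proof.
intros hd hl; apply is_derive_Reals in hd.
destruct (hd l hl) as [d H]; exists d; split; [apply cond_pos|].
intros h hh.
specialize (H (- h)); rewrite Rabs_Ropp, Rabs_pos_eq in H by lra.
assert (H1 : Rabs ((f (x + - h) - f x) / - h - l) < l) by (apply H; lra).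
apply Rabs_def2 in H1.
replace ((f (x + - h) - f x) / - h) with ((f x - f (x - h)) / h) in H1
  by (unfold Rminus; field; lra).
assert (0 < (f x - f (x - h)) / h * h) by (apply Rmult_lt_0_compat; lra).
replace ((f x - f (x - h)) / h * h) with (f x - f (x - h)) in H0 by (field; lra).
lra.
Qed.

(** The inequality is assumed only where [E <= 0]. Once positive, [E] cannot return to [0]: its
    derivative there would be positive. And [E] cannot stay nonpositive from the start, since
    [E * exp (- C t)] would then increase strictly from [0]. *)
Lemma pos_of_growth_where_nonpos (E dE : R -> R) (T C : R) :
  0 <= C -> E 0 = 0 ->
  (forall t, 0 <= t < T -> continuity_pt E t) ->
  (forall t, 0 < t < T -> is_derive E t (dE t)) ->
  (forall t, 0 < t < T -> E t <= 0 -> C * E t < dE t) ->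
  forall t, 0 < t < T -> 0 < E t.
Proof.
intros hC E0 hc hd hgrow t ht; apply Rnot_le_lt; intros hEt.
destruct (Classical_Prop.classic (exists s, 0 < s < t /\ 0 < E s)) as [[s [hs hEs]] | hno].
- destruct (first_hit (fun x => - E x) s t 0) as [x [hx [ex hbelow]]]; [lra | | lra |].
  + intros x hx; apply continuity_pt_opp, hc; lra.
  + assert (hdx : C * E x < dE x) by (apply hgrow; lra).
    replace (E x) with 0 in hdx by lra.
    destruct (derive_pos_left E x (dE x)) as [d [hd0 H]]; [apply hd; lra | lra|].
    assert (h1 := Rmin_l (d / 2) (x - s)); assert (h2 := Rmin_r (d / 2) (x - s)).
    assert (h3 : 0 < Rmin (d / 2) (x - s)) by (apply Rmin_glb_lt; lra).
    specialize (H (Rmin (d / 2) (x - s))); specialize (hbelow (x - Rmin (d / 2) (x - s))).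
    lra.
- assert (hle : forall s, 0 < s < t -> E s <= 0).
  { intros s hs; apply Rnot_lt_le; intros h; apply hno; exists s; auto. }
  set (g := fun x => - (E x * exp (- C * x))).
  assert (H : g t - g 0 < 0 * (t - 0)).
  { apply increment_lt with
      (df := fun x => - (dE x * exp (- C * x) + E x * (- C * exp (- C * x)))); [lra | | |].
    - intros x hx; unfold g; apply (is_derive_opp (fun x => E x * exp (- C * x))).
      apply (is_derive_mult E (fun x => exp (- C * x))); [apply hd; lra | | intros; apply Rmult_comm].
      auto_derive; [exact I | ring].
    - intros x hx; unfold g; apply continuity_pt_opp, continuity_pt_mult; [apply hc; lra|].
      apply (is_derive_continuity_pt _ _ (- C * exp (- C * x))); auto_derive; [exact I | ring].
    - intros x hx; assert (hx1 : C * E x < dE x) by (apply hgrow; [lra | auto]).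
      assert (hp := exp_pos (- C * x)).
      replace (- (dE x * exp (- C * x) + E x * (- C * exp (- C * x))))
        with (- ((dE x - C * E x) * exp (- C * x))) by ring.
      assert (0 < (dE x - C * E x) * exp (- C * x)) by (apply Rmult_lt_0_compat; lra); lra. }
  unfold g in H; rewrite E0 in H; assert (hp := exp_pos (- C * t)); nra.
Qed.

(* The squared slopes are compared at equal heights rather than at equal times:
   [theta t] is the time at which [u2] takes the value [u1 t]. *)
Lemma descent_time_le (sigma m T1 T2 : R) (g1 g2 u1 v1 u2 v2 : R -> R) :
  -1 <= sigma <= 1 -> 0 < T1 -> 0 < T2 ->
  (forall s, 0 < s < m -> g1 s < g2 s) ->
  (forall t, 0 <= t <= T1 -> continuity_pt u1 t) ->
  (forall t, 0 <= t <= T1 -> continuity_pt v1 t) ->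
  (forall t, 0 < t < T1 -> is_derive u1 t (v1 t)) ->
  (forall t, 0 < t < T1 -> is_derive v1 t (sigma * u1 t * v1 t - g1 (u1 t))) ->
  (forall t, 0 < t < T1 -> v1 t < 0) -> u1 0 = m -> v1 0 = 0 -> u1 T1 = 0 ->
  (forall t, 0 <= t <= T2 -> continuity_pt u2 t) ->
  (forall t, 0 <= t <= T2 -> continuity_pt v2 t) ->
  (forall t, 0 < t < T2 -> is_derive u2 t (v2 t)) ->
  (forall t, 0 < t < T2 -> is_derive v2 t (sigma * u2 t * v2 t - g2 (u2 t))) ->
  (forall t, 0 < t < T2 -> v2 t < 0) -> u2 0 = m -> v2 0 = 0 -> u2 T2 = 0 ->
  T2 <= T1.
Proof.
intros hs hT1 hT2 hg cu1 cv1 du1 dv1 n1 u10 v10 u1T cu2 cv2 du2 dv2 n2 u20 v20 u2T.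
assert (dec : forall u v T, (forall t, 0 <= t <= T -> continuity_pt u t) ->
  (forall t, 0 < t < T -> is_derive u t (v t)) -> (forall t, 0 < t < T -> v t < 0) ->
  forall x y, 0 <= x -> x < y -> y <= T -> u y < u x).
{ intros u v T hc hd hn x y hx hxy hy.
  assert (H : u y - u x < 0 * (y - x)); [|lra].
  apply increment_lt with v; [exact hxy | | |]; intros t ht; [apply hd | apply hc | apply hn]; lra. }
assert (dec1 := dec u1 v1 T1 cu1 du1 n1); assert (dec2 := dec u2 v2 T2 cu2 du2 n2).
destruct (decreasing_inverse u2 0 T2 hT2 cu2 dec2) as [G [hG [cG dG]]].
rewrite u20, u2T in hG; rewrite u20, u2T in dG.
set (theta := fun t => G (u1 t)).
assert (inj2 : forall x y, 0 <= x <= T2 -> 0 <= y <= T2 -> u2 x = u2 y -> x = y).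
{ intros x y hx hy e; destruct (Rtotal_order x y) as [h | [h | h]]; [|exact h|].
  - specialize (dec2 x y); lra.
  - specialize (dec2 y x); lra. }
assert (hm : 0 < m) by (rewrite <- u10, <- u1T; apply dec1; lra).
assert (range : forall t, 0 <= t <= T1 -> 0 <= u1 t <= m).
{ intros t ht; split.
  - rewrite <- u1T; destruct (proj2 ht) as [h | ->]; [apply Rlt_le, dec1 | ]; lra.
  - rewrite <- u10; destruct (proj1 ht) as [h | <-]; [apply Rlt_le, dec1 | ]; lra. }
assert (th : forall t, 0 <= t <= T1 -> 0 <= theta t <= T2 /\ u2 (theta t) = u1 t).
{ intros t ht; destruct (hG (u1 t)) as [h1 h2].
  rewrite clamp_id in h2 by (apply range, ht); auto. }
assert (th0 : theta 0 = 0).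
{ destruct (th 0) as [h1 h2]; [lra|]; apply inj2; lra. }
assert (thT : theta T1 = T2).
{ destruct (th T1) as [h1 h2]; [lra|]; apply inj2; lra. }
assert (cth : forall t, 0 <= t <= T1 -> continuity_pt theta t).
{ intros t ht; apply (continuity_pt_comp u1 G); [apply cu1, ht | apply cG]. }
assert (inner : forall t, 0 < t < T1 -> 0 < u1 t < m /\ 0 < theta t < T2).
{ intros t ht.
  assert (h1 : u1 T1 < u1 t) by (apply dec1; lra).
  assert (h2 : u1 t < u1 0) by (apply dec1; lra).
  split; [lra|]; destruct (th t) as [[h3 h4] h5]; [lra|]; split.
  - destruct h3 as [h3 | h3]; [exact h3|]; rewrite <- h3 in h5; lra.
  - destruct h4 as [h4 | h4]; [exact h4|]; rewrite h4 in h5; lra. }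
assert (dth : forall t, 0 < t < T1 -> is_derive theta t (v1 t / v2 (theta t))).
{ intros t ht; destruct (inner t ht) as [h1 h2].
  apply (is_derive_comp G u1 t (/ v2 (theta t)) (v1 t)); [|apply du1, ht].
  apply dG; [exact h1 | apply du2, h2 | ].
  specialize (n2 (theta t) h2); unfold theta in n2; unfold theta; lra. }
(* In [dE] the factor [1 / v2] from the derivative of [theta] cancels the [v2] from that of the
   square, so nothing singular remains near the peak, where both slopes vanish. *)
set (E := fun t => v2 (theta t) ^ 2 - v1 t ^ 2).
set (dE := fun t => 2 * v1 t * ((sigma * u1 t * v2 (theta t) - g2 (u1 t))
  - (sigma * u1 t * v1 t - g1 (u1 t)))).
assert (Epos : forall t, 0 < t < T1 -> 0 < E t).
{ apply (pos_of_growth_where_nonpos E dE T1 (2 * m)).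
  - lra.
  - unfold E; rewrite th0, v20, v10; ring.
  - intros t ht; assert (ht' : 0 <= t <= T1) by lra; unfold E; simpl.
    assert (cc : continuity_pt (fun t => v2 (theta t)) t).
    { apply (continuity_pt_comp theta v2); [apply cth, ht' | apply cv2, th, ht']. }
    apply continuity_pt_minus; repeat apply continuity_pt_mult; auto;
      apply continuity_pt_const; intros ? ?; reflexivity.
  - intros t ht; destruct (inner t ht) as [h1 h2].
    assert (hn2 := n2 _ h2).
    assert (dv2t := dv2 _ h2).
    destruct (th t) as [_ e]; [lra|]; rewrite e in dv2t.
    assert (H2 := is_derive_comp v2 theta t _ _ dv2t (dth t ht)).
    assert (H := is_derive_minus _ _ _ _ _ (is_derive_pow _ 2 t _ H2)
      (is_derive_pow _ 2 t _ (dv1 t ht))).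
    unfold dE.
    refine (eq_rect _ (fun l => is_derive E t l) H _ _).
    unfold minus, plus, opp, scal; simpl; unfold mult; simpl; field; lra.
  - intros t ht hE; destruct (inner t ht) as [h1 h2].
    assert (hn2 := n2 _ h2); assert (hn1 := n1 t ht); specialize (hg _ h1).
    unfold E in hE |- *; unfold dE.
    set (x := - v1 t); set (y := - v2 (theta t)).
    replace (v1 t) with (- x) in * by (unfold x; ring).
    replace (v2 (theta t)) with (- y) in * by (unfold y; ring).
    assert (hyx : y <= x) by (apply Rnot_lt_le; intros h; nra).
    set (s := u1 t) in *.
    assert (h3 : 0 < x * (g2 s - g1 s)) by (apply Rmult_lt_0_compat; lra).
    assert (h4 : sigma * s <= m) by nra.
    assert (h5 : 0 <= x * (x - y)) by (apply Rmult_le_pos; lra).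
    assert (h6 : 0 <= (m - sigma * s) * (x * (x - y))) by (apply Rmult_le_pos; lra).
    assert (h7 : 0 <= m * (y * (x - y))) by (repeat apply Rmult_le_pos; lra).
    nra. }
(* At equal heights the second descent is faster, so [theta] has derivative at most [1]; it maps
   [[0, T1]] onto [[0, T2]]. *)
rewrite <- thT; assert (H : theta T1 - theta 0 <= 1 * (T1 - 0)); [|lra].
apply increment_le with (fun t => v1 t / v2 (theta t)); [lra | exact dth | exact cth|].
intros t ht; destruct (inner t ht) as [h1 h2]; assert (hn2 := n2 _ h2); assert (hn1 := n1 t ht).
specialize (Epos t ht); unfold E in Epos.
replace (v1 t / v2 (theta t)) with ((- v1 t) / (- v2 (theta t))) by (field; lra).
apply Rcomplements.Rle_div_l; nra.
Qed.

Section Existence.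
Variables (p lambda : R).
Hypothesis (hp : 3 <= p) (hl : 0 < lambda).

(* For [p >= 3] the dilation [u |-> k u(k t)], [k > 1], weakens the nonlinearity
   and keeps the term [u u']. *)
Lemma hits_lt (sigma m1 m2 L1 L2 : R) (u1 v1 u2 v2 : R -> R) :
  -1 <= sigma <= 1 -> hits p lambda sigma m1 L1 u1 v1 -> hits p lambda sigma m2 L2 u2 v2 ->
  (forall t, 0 < t < L1 -> v1 t < 0) -> (forall t, 0 < t < L2 -> v2 t < 0) ->
  m1 < m2 -> L2 < L1.
Proof.
intros hs [hL1 [[cu1 [cv1 [du1 dv1]]] [u10 [v10 [pu1 u1L]]]]]
  [hL2 [[cu2 [cv2 [du2 dv2]]] [u20 [v20 [pu2 u2L]]]]] n1 n2 hm.
assert (hm1 : 0 < m1) by (rewrite <- u10; apply pu1; lra).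
(* This dilation lifts the first peak to the height of the second and shortens its descent to
   [L1 / k]. The comparison yields [L2 <= L1 / k], and strictness comes from [k > 1]. *)
set (k := m2 / m1).
assert (hk : 1 < k) by (unfold k; apply Rcomplements.Rlt_div_r; lra).
assert (hLk : L1 / k < L1) by (apply Rcomplements.Rlt_div_l; nra).
assert (hLk0 : 0 < L1 / k) by (apply Rdiv_lt_0_compat; lra).
apply Rle_lt_trans with (L1 / k); [|exact hLk].
assert (inside : forall t, 0 <= t <= L1 / k -> 0 <= k * t <= L1).
{ intros t ht; split; [nra|]; replace L1 with (k * (L1 / k)) by (field; lra).
  apply Rmult_le_compat_l; lra. }
assert (inside' : forall t, 0 < t < L1 / k -> 0 < k * t < L1).
{ intros t ht; split; [nra|]; replace L1 with (k * (L1 / k)) by (field; lra).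
  apply Rmult_lt_compat_l; lra. }
assert (dk : forall t, is_derive (fun t => k * t) t k) by (intros; auto_derive; [exact I | ring]).
assert (ck : forall t, continuity_pt (fun t => k * t) t)
  by (intros; eapply is_derive_continuity_pt, dk).
apply (descent_time_le sigma m2 (L1 / k) L2
  (fun s => k ^ 3 * nonlinearity p lambda (s / k)) (nonlinearity p lambda)
  (fun t => k * u1 (k * t)) (fun t => k ^ 2 * v1 (k * t)) u2 v2); auto.
- intros s hs0.
  assert (hw : 0 < s / k) by (apply Rdiv_lt_0_compat; lra).
  set (w := s / k) in *.
  assert (es : s = k * w) by (unfold w; field; lra).
  rewrite es, !nonlinearity_pos by nra.
  assert (hq : k ^ 2 <= Rpower k (p - 1)).
  { rewrite <- Rpower_pow by lra; apply Rle_Rpower; simpl; lra. }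
  assert (hpw : 0 < Rpower w (p - 1)) by apply exp_pos.
  rewrite <- Rpower_mult_distr by lra.
  assert (h1 : k ^ 2 * Rpower w (p - 1) <= Rpower k (p - 1) * Rpower w (p - 1))
    by (apply Rmult_le_compat_r; lra).
  assert (h2 : 1 < k ^ 2) by nra.
  (* For [p = 3] the two powers agree, and strictness rests on [lambda < k ^ 2 * lambda]. *)
  assert (h3 : k ^ 2 * (Rpower w (p - 1) - lambda) < Rpower k (p - 1) * Rpower w (p - 1) - lambda)
    by nra.
  replace (k ^ 3 * (w * (Rpower w (p - 1) - lambda)))
    with (k * w * (k ^ 2 * (Rpower w (p - 1) - lambda))) by ring.
  apply Rmult_lt_compat_l; [nra | exact h3].
- intros t ht; apply continuity_pt_scal, (continuity_pt_comp (fun t => k * t) u1); auto.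
- intros t ht; apply continuity_pt_scal, (continuity_pt_comp (fun t => k * t) v1); auto.
- intros t ht.
  assert (H := is_derive_scal _ t k _
    (is_derive_comp u1 (fun t => k * t) t _ _ (du1 _ (inside' t ht)) (dk t))).
  replace (k ^ 2 * v1 (k * t)) with (k * scal k (v1 (k * t))); [exact H|].
  unfold scal; simpl; unfold mult; simpl; ring.
- intros t ht.
  assert (H := is_derive_scal _ t (k ^ 2) _
    (is_derive_comp v1 (fun t => k * t) t _ _ (dv1 _ (inside' t ht)) (dk t))).
  refine (eq_rect _ (fun l => is_derive _ t l) H _ _).
  replace (k * u1 (k * t) / k) with (u1 (k * t)) by (field; lra).
  unfold scal; simpl; unfold mult; simpl; ring.
- intros t ht; specialize (n1 (k * t) (inside' t ht)).
  assert (0 < k ^ 2 * - v1 (k * t)) by (apply Rmult_lt_0_compat; [apply pow_lt|]; lra); lra.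
- rewrite Rmult_0_r, u10; unfold k; field; lra.
- rewrite Rmult_0_r, v10; ring.
- replace (k * (L1 / k)) with L1 by (field; lra); rewrite u1L; ring.
Qed.

(** The slope starts at [0] and grows at rate at most [1 + lambda], so the logarithm of [u] grows at
    rate at most [(1 + lambda) * L]. This keeps the shooting solutions below the truncation
    level. *)
Lemma solves_upper_bound (sigma L : R) (u v : R -> R) (t : R) :
  -1 <= sigma <= 1 -> solves p lambda sigma 0 L u v -> (forall t, 0 <= t <= L -> 0 < u t) ->
  v 0 = 0 -> 0 <= t <= L -> u t <= u 0 * exp ((1 + lambda) * L ^ 2).
Proof.
intros hs hsol hu v0 ht.
destruct (log_derive p lambda sigma 0 L u v hsol hu) as [ld lc].
assert (H : ln (u t) - ln (u 0) <= (1 + lambda) * L * (t - 0)).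
{ apply (increment_le (fun t => ln (u t)) (fun t => v t / u t)); [lra | | |].
  - intros x hx; apply ld; lra.
  - intros x hx; apply lc; lra.
  - intros x hx.
    assert (H := log_slope_le p lambda hp sigma 0 L u v 0 x hs hsol hu).
    rewrite v0 in H; unfold Rdiv at 2 in H; rewrite Rmult_0_l in H.
    assert (v x / u x <= 0 + (1 + lambda) * (x - 0)) by (apply H; lra); nra. }
assert (h0 : 0 < u 0) by (apply hu; lra); assert (h1 : 0 < u t) by (apply hu, ht).
assert (H1 : ln (u t) <= ln (u 0) + (1 + lambda) * L ^ 2).
{ assert (0 <= (1 + lambda) * L * (L - t)) by (repeat apply Rmult_le_pos; lra); nra. }
rewrite <- (exp_ln (u t)), <- (exp_ln (u 0)) at 1 by assumption.
rewrite <- exp_plus.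
destruct H1 as [H1 | ->]; [apply Rlt_le, exp_increasing, H1 | lra].
Qed.

(* The slope [v / u] first drops below [- R], and then the Riccati inequality
   [r' <= - r^2 / 4] makes it blow down before time [L]. *)
Lemma solves_initial_bound (L : R) :
  0 < L -> exists M, 0 < M /\ forall (sigma : R) (u v : R -> R),
    -1 <= sigma <= 1 -> solves p lambda sigma 0 L u v ->
    (forall t, 0 <= t <= L -> 0 < u t) -> v 0 = 0 -> u 0 < M.
Proof.
intros hL.
(* [Rr] is chosen so that [16 * La <= Rr ^ 2] and [/ Rr < L / 8]. [X] is chosen so that [u^2 >= X]
   forces [r' <= - 2 Rr / L], a drop by [Rr] in time [L / 2]. While [r > - Rr] on that half, [u]
   loses at most a factor [exp (Rr * (L / 2))]; whence the threshold for [u 0]. *)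
set (La := 1 + lambda); set (Rr := 4 * La + 8 / L + 1).
set (X := 2 * (La + 2 * Rr / L)).
assert (hLa : 1 < La) by (unfold La; lra).
assert (h8 : 0 < 8 / L) by (apply Rdiv_lt_0_compat; lra).
assert (hR : 0 < Rr) by (unfold Rr; lra).
assert (hX : 0 < X).
{ assert (0 < 2 * Rr / L) by (apply Rdiv_lt_0_compat; lra); unfold X; lra. }
exists (exp (Rr * (L / 2)) * (1 + X)); split.
{ apply Rmult_lt_0_compat; [apply exp_pos | lra]. }
intros sigma u v hs hsol hu v0; apply Rnot_le_lt; intros hM.
destruct (log_slope_derive p lambda sigma 0 L u v hsol hu) as [rd rc].
destruct (log_derive p lambda sigma 0 L u v hsol hu) as [ld lc].
assert (rle : forall t, 0 <= t <= L -> log_slope_derivative p lambda sigma u v t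
  <= La - (u t ^ 2 + (v t / u t) ^ 2) / 2).
{ intros t ht; apply log_slope_derivative_le; auto. }
set (r := fun t => v t / u t) in *.
assert (step1 : exists t, 0 <= t <= L / 2 /\ r t <= - Rr).
{ apply Classical_Prop.NNPP; intros hno.
  assert (hr : forall t, 0 <= t <= L / 2 -> - Rr < r t).
  { intros t ht; apply Rnot_le_lt; intros h; apply hno; exists t; auto. }
  assert (hlow : forall t, 0 <= t <= L / 2 -> 1 + X <= u t).
  { intros t ht.
    assert (H : - ln (u t) - - ln (u 0) <= Rr * (t - 0)).
    { apply (increment_le (fun t => - ln (u t)) (fun t => - r t)); [lra | | |].
      - intros x hx; apply (is_derive_opp (fun t => ln (u t))), ld; lra.
      - intros x hx; apply continuity_pt_opp, lc; lra.
      - intros x hx; specialize (hr x); lra. }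
    assert (hut : 0 < u t) by (apply hu; lra).
    assert (hu0 : 0 < u 0) by (apply hu; lra).
    assert (H1 : ln (u 0) <= Rr * (L / 2) + ln (u t)) by nra.
    assert (H2 : u 0 <= exp (Rr * (L / 2)) * u t).
    { rewrite <- (exp_ln (u 0)), <- (exp_ln (u t)), <- exp_plus by assumption.
      destruct H1 as [H1 | ->]; [apply Rlt_le, exp_increasing, H1 | lra]. }
    apply Rmult_le_reg_l with (exp (Rr * (L / 2))); [apply exp_pos | lra]. }
  assert (H : r (L / 2) - r 0 <= - (2 * Rr / L) * (L / 2 - 0)).
  { apply (increment_le r (log_slope_derivative p lambda sigma u v)); [lra | | |].
    - intros x hx; apply rd; lra.
    - intros x hx; apply rc; lra.
    - intros x hx; eapply Rle_trans; [apply rle; lra|].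
      assert (h1 := hlow x ltac:(lra)); assert (h2 := pow2_ge_0 (v x / u x)).
      assert (h3 : X <= u x ^ 2) by nra; unfold X in h3; lra. }
  assert (hr0 : r 0 = 0) by (unfold r; rewrite v0; unfold Rdiv; ring).
  replace (- (2 * Rr / L) * (L / 2 - 0)) with (- Rr) in H by (field; lra).
  specialize (hr (L / 2)); lra. }
destruct step1 as [t1 [ht1 hr1]].
assert (hRL : 16 * La <= Rr ^ 2) by (unfold Rr; nra).
(* While [r] is below [- Rr / 2], the square outweighs [La] and [r] decreases, so it cannot climb
   back to that level. *)
assert (stay : forall t, t1 <= t <= L -> r t < - (Rr / 2)).
{ intros t ht; apply Rnot_le_lt; intros hrt.
  destruct (first_hit r t1 t (- (Rr / 2))) as [t2 [ht2 [e hbelow]]]; [lra | | lra |].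
  - intros x hx; apply rc; lra.
  - assert (H : r t2 - r t1 <= 0 * (t2 - t1)); [|lra].
    apply (increment_le r (log_slope_derivative p lambda sigma u v)); [lra | | |].
    + intros x hx; apply rd; lra.
    + intros x hx; apply rc; lra.
    + intros x hx; eapply Rle_trans; [apply rle; lra|].
      assert (h1 := hbelow x ltac:(lra)); assert (h2 := pow2_ge_0 (u x)).
      fold (r x); assert (h3 : (Rr / 2) ^ 2 <= r x ^ 2) by nra; nra. }
(* Integrated form of [r' <= - r^2 / 4]. The left side is at least [L / 8], while the right side is
   below [/ Rr], itself smaller than [L / 8]. *)
assert (H : / 4 * (L - t1) <= / r L - / r t1).
{ assert (H : - / r L - - / r t1 <= - / 4 * (L - t1)); [|lra].
  apply (increment_le (fun t => - / r t)
    (fun t => log_slope_derivative p lambda sigma u v t / r t ^ 2)); [lra | | |].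
  - intros x hx; assert (hx0 := stay x ltac:(lra)).
    assert (hdx := is_derive_opp _ _ _ (is_derive_inv r x _ (rd x ltac:(lra)) ltac:(lra))).
    refine (eq_rect _ (fun l => is_derive _ x l) hdx _ _).
    unfold opp; simpl; field; lra.
  - intros x hx; assert (hx0 := stay x ltac:(lra)).
    apply continuity_pt_opp, continuity_pt_inv; [apply rc; lra | lra].
  - intros x hx; assert (hx0 := stay x ltac:(lra)).
    assert (hx1 := rle x ltac:(lra)); fold (r x) in hx1.
    assert (h2 := pow2_ge_0 (u x)).
    assert (h3 : (Rr / 2) ^ 2 <= r x ^ 2) by nra.
    apply Rcomplements.Rle_div_l; nra. }
assert (hrL := stay L ltac:(lra)).
assert (h1 : / r L < 0) by (apply Rinv_lt_0_compat; lra).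
assert (h2 : - / Rr <= / r t1).
{ rewrite <- Rinv_opp; destruct hr1 as [hr1 | ->]; [|lra].
  apply Rlt_le, Rinv_lt_contravar; [nra | exact hr1]. }
assert (h3 : / Rr < L / 8).
{ replace (L / 8) with (/ (8 / L)) by (field; lra).
  apply Rinv_lt_contravar; [nra | unfold Rr; lra]. }
lra.
Qed.

(** For [u <= 0] the truncated system reads [u' = z], [z' = 0], so after its zero the solution is a
    straight line of negative slope. The sign of [u] at the final time therefore reveals an earlier
    zero, which makes that value a suitable shooting function. *)
Lemma trunc_negative_after_zero (sigma K L t0 : R) (u z : R -> R) :
  -1 <= sigma <= 1 -> 0 < K ->
  planar_solution (trunc_quad sigma K) (trunc_nl p lambda K) 0 L u z ->
  0 < t0 < L -> (forall t, 0 <= t < t0 -> 0 < u t <= K) -> u t0 = 0 ->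
  forall t, t0 < t <= L -> u t < 0.
Proof.
intros hs hK hpl ht0 hu ut0 t ht.
destruct (trunc_lipschitz p lambda sigma K hp hl hs hK) as [C [hC [hc hd]]].
assert (hpl' : forall a b, 0 <= a -> b <= L ->
  planar_solution (trunc_quad sigma K) (trunc_nl p lambda K) a b u z).
{ intros a b ha hb; destruct hpl as [h1 [h2 [h3 h4]]].
  refine (conj _ (conj _ (conj _ _))); intros s hsab; [apply h1|apply h2|apply h3|apply h4]; lra. }
assert (clamp_neg : forall x, x <= 0 -> clamp 0 K x = 0).
{ intros x hx; unfold clamp; rewrite Rmin_right, Rmax_left by lra; reflexivity. }
assert (hz : z t0 <> 0).
{ assert (hsol : solves p lambda sigma 0 t0 u (fun t => z t + sigma / 2 * u t ^ 2)).
  { apply planar_solves with K; [apply hpl'; lra|]; intros s hst.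
    destruct (proj2 hst) as [h | ->]; [specialize (hu s); lra | lra]. }
  intros hz; refine (solves_zero_slope p lambda hp hl sigma 0 t0 u _ t0 hs hsol _ _ _ ut0 _);
    [intros; apply hu; lra | lra | lra |].
  simpl; rewrite ut0, hz; ring. }
(* A positive slope would make [u] negative just before [t0]. *)
assert (hz' : z t0 < 0).
{ apply Rnot_le_lt; intros h.
  destruct hpl as [_ [_ [h3 _]]]; specialize (h3 t0 ht0); unfold trunc_quad in h3.
  rewrite ut0, clamp_neg in h3 by lra.
  destruct (derive_pos_left u t0 _ h3) as [d [hd0 H]]; [lra|].
  assert (h1 := Rmin_l (d / 2) t0); assert (h2 := Rmin_r (d / 2) t0).
  assert (h4 : 0 < Rmin (d / 2) t0) by (apply Rmin_glb_lt; lra).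
  specialize (H (Rmin (d / 2) t0)); specialize (hu (t0 - Rmin (d / 2) t0)); lra. }
assert (line : planar_solution (trunc_quad sigma K) (trunc_nl p lambda K) t0 L
  (fun t => z t0 * (t - t0)) (fun _ => z t0)).
{ assert (dl : forall s, is_derive (fun t => z t0 * (t - t0)) s (z t0))
    by (intros; auto_derive; [exact I | ring]).
  assert (hneg : forall s, t0 < s -> z t0 * (s - t0) <= 0) by (intros; nra).
  refine (conj _ (conj _ (conj _ _))); intros s hst.
  - eapply is_derive_continuity_pt, dl.
  - apply continuity_pt_const; intros ? ?; reflexivity.
  - unfold trunc_quad; rewrite clamp_neg by (apply hneg; lra).
    replace (z t0 + sigma / 2 * 0 ^ 2) with (z t0) by ring; apply dl.
  - unfold trunc_nl; rewrite clamp_neg by (apply hneg; lra).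
    rewrite nonlinearity_0, Ropp_0; apply (is_derive_const (z t0)). }
destruct (planar_unique _ _ C t0 L u z _ _ t0 hC hc hd (hpl' t0 L ltac:(lra) ltac:(lra)) line)
  with (x := t) as [e _]; [lra | lra | reflexivity | lra|].
rewrite e; nra.
Qed.

(** If the descent from [m0] has not reached zero by time [L], then [u L > 0] for the peak [m0] and
    [u L <= 0] for a very high peak; an intermediate peak has [u L = 0]. Both alternatives are
    exploited later, by excluding one or the other. *)
Lemma hits_exists (sigma L m0 : R) :
  -1 <= sigma <= 1 -> 0 < L -> 0 < m0 ->
  (exists L' u v, L' <= L /\ hits p lambda sigma m0 L' u v) \/
  (exists m u v, m0 < m /\ hits p lambda sigma m L u v).
Proof.
intros hs hL hm0.
destruct (solves_initial_bound L hL) as [M [hM bound]].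
(* For peaks up to [Mx], the a priori bound is [K - 1], so positive solutions never meet the
   truncation. *)
set (Mx := Rmax M m0).
assert (hMx : M <= Mx) by apply Rmax_l; assert (hMx' : m0 <= Mx) by apply Rmax_r.
set (K := Mx * exp ((1 + lambda) * L ^ 2) + 1).
assert (hK : 0 < K).
{ assert (0 < Mx * exp ((1 + lambda) * L ^ 2)) by (apply Rmult_lt_0_compat; [lra | apply exp_pos]).
  unfold K; lra. }
destruct (trunc_lipschitz p lambda sigma K hp hl hs hK) as [C [hC [hc hd]]].
assert (ex : forall m, exists uz : (R -> R) * (R -> R),
  planar_solution (trunc_quad sigma K) (trunc_nl p lambda K) 0 L (fst uz) (snd uz) /\
  fst uz 0 = m /\ snd uz 0 = - (sigma / 2 * m ^ 2)).
{ intros m.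
  destruct (picard_exists _ _ C m (- (sigma / 2 * m ^ 2)) hC hc hd)
    as [u [z [h1 [h2 [h3 [h4 [h5 h6]]]]]]].
  exists (u, z); refine (conj _ (conj h3 h4)).
  refine (conj _ (conj _ (conj _ _))); intros t ht; auto; [apply h5 | apply h6]; lra. }
set (F := fun m => proj1_sig (constructive_indefinite_description _ (ex m))).
assert (hF : forall m, planar_solution (trunc_quad sigma K) (trunc_nl p lambda K) 0 L
  (fst (F m)) (snd (F m)) /\ fst (F m) 0 = m /\ snd (F m) 0 = - (sigma / 2 * m ^ 2)).
{ intros m; exact (proj2_sig (constructive_indefinite_description _ (ex m))). }
clearbody F.
set (U := fun m => fst (F m)); set (Z := fun m => snd (F m)).
set (V := fun m t => Z m t + sigma / 2 * U m t ^ 2).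
assert (hU : forall m, planar_solution (trunc_quad sigma K) (trunc_nl p lambda K) 0 L (U m) (Z m))
  by (intros; apply hF).
assert (hU0 : forall m, U m 0 = m) by (intros; apply hF).
assert (hV0 : forall m, V m 0 = 0).
{ intros m; unfold V; rewrite hU0; destruct (hF m) as [_ [_ e]]; fold (Z m) in e; rewrite e; ring. }
assert (hUc : forall m t, 0 <= t <= L -> continuity_pt (U m) t) by (intros m; apply hU).
assert (sol : forall m t, 0 <= t <= L -> (forall s, 0 <= s <= t -> 0 <= U m s <= K) ->
  solves p lambda sigma 0 t (U m) (V m)).
{ intros m t ht hb; apply planar_solves with K; [|exact hb].
  destruct (hU m) as [h1 [h2 [h3 h4]]].
  refine (conj _ (conj _ (conj _ _))); intros s hst; [apply h1|apply h2|apply h3|apply h4]; lra. }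
assert (below : forall m t, 0 < m <= Mx -> 0 <= t <= L ->
  (forall s, 0 <= s <= t -> 0 < U m s) -> U m t < K).
{ intros m t hm ht hpos; apply Rnot_le_lt; intros hKt.
  assert (hexp : 1 <= exp ((1 + lambda) * L ^ 2)).
  { assert (H := exp_ineq1_le ((1 + lambda) * L ^ 2)).
    assert (0 <= (1 + lambda) * L ^ 2) by (apply Rmult_le_pos; [lra | apply pow2_ge_0]); lra. }
  assert (hmK : m < K) by (unfold K; nra).
  destruct (first_hit (U m) 0 t K) as [x [hx [e hbelow]]]; [lra | | rewrite hU0; lra |].
  { intros s hst; apply hUc; lra. }
  assert (hsx : solves p lambda sigma 0 x (U m) (V m)).
  { apply sol; [lra|]; intros s hsx; assert (0 < U m s) by (apply hpos; lra).
    destruct (proj2 hsx) as [h | ->]; [specialize (hbelow s); lra | lra]. }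
  assert (H : U m x <= U m 0 * exp ((1 + lambda) * x ^ 2)).
  { apply (solves_upper_bound sigma x (U m) (V m)); auto; [|lra].
    intros s hsx'; apply hpos; lra. }
  rewrite e, hU0 in H.
  assert (hex : exp ((1 + lambda) * x ^ 2) <= exp ((1 + lambda) * L ^ 2)).
  { assert (h1 : x ^ 2 <= L ^ 2) by (apply pow_incr; lra).
    assert (h2 : (1 + lambda) * x ^ 2 <= (1 + lambda) * L ^ 2) by (apply Rmult_le_compat_l; lra).
    destruct h2 as [h2 | ->]; [apply Rlt_le, exp_increasing, h2 | lra]. }
  assert (m * exp ((1 + lambda) * x ^ 2) <= Mx * exp ((1 + lambda) * L ^ 2)).
  { apply Rmult_le_compat; try lra; apply Rlt_le, exp_pos. }
  unfold K in H; lra. }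
assert (first : forall m t, 0 < m <= Mx -> 0 <= t <= L -> U m t <= 0 ->
  exists t0, 0 < t0 <= t /\ hits p lambda sigma m t0 (U m) (V m) /\
    (forall s, 0 <= s < t0 -> 0 < U m s <= K)).
{ intros m t hm ht hUt.
  destruct (first_hit (fun s => - U m s) 0 t 0) as [t0 [ht0 [e hbelow]]];
    [lra | | rewrite hU0; lra |].
  { intros s hst; apply continuity_pt_opp, hUc; lra. }
  assert (hpos : forall s, 0 <= s < t0 -> 0 < U m s <= K).
  { intros s hst; split; [specialize (hbelow s); lra|].
    apply Rlt_le, below; [exact hm | lra|]; intros x hx; specialize (hbelow x); lra. }
  exists t0; split; [exact ht0 | split; [|exact hpos]].
  refine (conj _ (conj _ (conj _ (conj _ (conj _ _))))); auto; try lra.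
  - apply sol; [lra|]; intros s hst.
    destruct (proj2 hst) as [h | ->]; [specialize (hpos s); lra | lra].
  - intros s hst; apply hpos, hst. }
assert (allpos : forall m, 0 < m <= Mx -> (forall t, 0 <= t <= L -> 0 < U m t) -> m < M).
{ intros m hm hpos; rewrite <- (hU0 m); apply (bound sigma (U m) (V m)); auto.
  apply sol; [lra|]; intros s hsL; split; [apply Rlt_le, hpos, hsL|].
  apply Rlt_le, below; [exact hm | exact hsL | intros x hx; apply hpos; lra]. }
assert (neg : forall m t0, 0 < t0 <= L -> hits p lambda sigma m t0 (U m) (V m) ->
  (forall s, 0 <= s < t0 -> 0 < U m s <= K) -> t0 = L \/ U m L < 0).
{ intros m t0 ht0 [_ [_ [_ [_ [_ e]]]]] hpos.
  destruct (proj2 ht0) as [h | h]; [right | left; exact h].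
  apply (trunc_negative_after_zero sigma K L t0 (U m) (Z m)); auto; lra. }
destruct (Classical_Prop.classic (exists t, 0 <= t <= L /\ U m0 t <= 0)) as [[t [ht hUt]] | hno].
{ left; destruct (first m0 t) as [t0 [ht0 [hh _]]]; [lra | exact ht | exact hUt |].
  exists t0, (U m0), (V m0); split; [lra | exact hh]. }
right.
assert (pos0 : forall t, 0 <= t <= L -> 0 < U m0 t).
{ intros t ht; apply Rnot_le_lt; intros h; apply hno; exists t; auto. }
assert (hm0M : m0 < M) by (apply allpos; [lra | exact pos0]).
assert (negM : U M L <= 0).
{ destruct (Classical_Prop.classic (exists t, 0 <= t <= L /\ U M t <= 0)) as [[t [ht hUt]] | hnoM].
  - destruct (first M t) as [t0 [ht0 [hh hpos]]]; [lra | exact ht | exact hUt |].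
    destruct (neg M t0) as [-> | h]; [lra | exact hh | exact hpos | | lra].
    destruct hh as [_ [_ [_ [_ [_ e]]]]]; lra.
  - exfalso; assert (M < M); [|lra].
    apply allpos; [lra|]; intros t ht; apply Rnot_le_lt; intros h; apply hnoM; exists t; auto. }
destruct (first_hit (fun m => - U m L) m0 M 0) as [m [hm [e _]]]; [lra | | |].
- intros m _; apply continuity_pt_opp, continuity_pt_eps; intros eps he.
  (* The initial data are [(m, - sigma / 2 * m^2)]; for [|y - m| < 1] their squared distance is at
     most [(y - m)^2 * (1 + (2 |m| + 1)^2)]. As [1 <= S], the factor [S] can replace its square
     root. *)
  set (S := (1 + (2 * Rabs m + 1) ^ 2) * exp (4 * C * L)).
  assert (hS : 1 <= S).
  { assert (H := exp_ineq1_le (4 * C * L)); assert (0 <= 4 * C * L) by nra.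
    assert (h1 := pow2_ge_0 (2 * Rabs m + 1)); unfold S; nra. }
  exists (Rmin 1 (eps / S)); split.
  { apply Rmin_glb_lt; [lra | apply Rdiv_lt_0_compat; lra]. }
  intros y hy.
  assert (hy1 : Rabs (y - m) < 1) by (eapply Rlt_le_trans; [exact hy | apply Rmin_l]).
  assert (hy2 : Rabs (y - m) < eps / S) by (eapply Rlt_le_trans; [exact hy | apply Rmin_r]).
  assert (hy3 : Rabs (y - m) * S < eps) by (apply Rcomplements.Rlt_div_r in hy2; lra).
  eapply Rle_lt_trans; [|exact hy3].
  assert (H := planar_dependence _ _ C 0 L _ _ _ _ hC hc hd (hU y) (hU m) L 0 ltac:(lra) ltac:(lra)).
  rewrite !hU0, (Rabs_pos_eq (L - 0)), Rminus_0_r in H by lra.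
  destruct (hF y) as [_ [_ ey]]; destruct (hF m) as [_ [_ em]].
  fold (Z y) in ey; fold (Z m) in em; rewrite ey, em in H.
  assert (hym : (y + m) ^ 2 <= (2 * Rabs m + 1) ^ 2).
  { rewrite <- (pow2_abs (y + m)); apply pow_incr; split; [apply Rabs_pos|].
    replace (y + m) with (2 * m + (y - m)) by ring.
    eapply Rle_trans; [apply Rabs_triang|]; rewrite Rabs_mult, (Rabs_pos_eq 2) by lra; lra. }
  assert (hz : (- (sigma / 2 * y ^ 2) - - (sigma / 2 * m ^ 2)) ^ 2
    <= (y - m) ^ 2 * (2 * Rabs m + 1) ^ 2).
  { replace ((- (sigma / 2 * y ^ 2) - - (sigma / 2 * m ^ 2)) ^ 2)
      with ((sigma ^ 2 / 4) * ((y - m) ^ 2 * (y + m) ^ 2)) by field.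
    assert (h1 := pow2_ge_0 (y - m)); assert (h2 := pow2_ge_0 (y + m)).
    assert (h3 : (y - m) ^ 2 * (y + m) ^ 2 <= (y - m) ^ 2 * (2 * Rabs m + 1) ^ 2)
      by (apply Rmult_le_compat_l; lra).
    assert (h4 : 0 <= (y - m) ^ 2 * (y + m) ^ 2) by (apply Rmult_le_pos; lra).
    assert (h5 : sigma ^ 2 / 4 <= 1) by nra.
    nra. }
  assert (hsq : (U y L - U m L) ^ 2 <= (Rabs (y - m) * S) ^ 2).
  { assert (h1 := pow2_ge_0 (Z y L - Z m L)); assert (h2 := exp_pos (4 * C * L)).
    assert (h3 : (U y L - U m L) ^ 2 <= (y - m) ^ 2 * S).
    { unfold S; apply Rle_trans with
        (((y - m) ^ 2 + (y - m) ^ 2 * (2 * Rabs m + 1) ^ 2) * exp (4 * C * L)); [|lra].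
      apply Rle_trans with (2 := Rmult_le_compat_r _ _ _ (Rlt_le _ _ h2)
        (Rplus_le_compat_l ((y - m) ^ 2) _ _ hz)); lra. }
    rewrite Rpow_mult_distr, pow2_abs.
    assert (h4 := pow2_ge_0 (y - m)).
    assert ((y - m) ^ 2 * S <= (y - m) ^ 2 * S ^ 2) by (apply Rmult_le_compat_l; nra).
    lra. }
  apply Rsqr_incr_0_var; [|apply Rmult_le_pos; [apply Rabs_pos | lra]].
  rewrite <- Rsqr_abs; unfold Rsqr; nra.
- split; [|lra]; specialize (pos0 L); lra.
- exists m, (U m), (V m); split; [lra|].
  destruct (first m L) as [t0 [ht0 [hh hpos]]]; [lra | lra | lra |].
  (* A zero before [L] would make the value at [L] negative instead of [0]. *)
  destruct (neg m t0) as [-> | h]; [lra | exact hh | exact hpos | exact hh | lra].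
Qed.

End Existence.

(** * Boundary value problems *)

(** The mean value theorem turns continuity of [g] at [x] into differentiability of [f] there. This
    gives the one-sided derivatives at endpoints and fills in the point where two solutions are
    glued. *)
Lemma slope_limit (f g : R -> R) (a b x : R) :
  (forall t, a <= t <= b -> continuity_pt f t) ->
  (forall t, a < t < b -> t <> x -> is_derive f t (g t)) -> continuity_pt g x ->
  a <= x <= b -> forall eps, 0 < eps -> exists d, 0 < d /\
    forall y, a <= y <= b -> y <> x -> Rabs (y - x) < d ->
      Rabs ((f y - f x) / (y - x) - g x) < eps.
Proof.
intros hc hd hg hx eps he.
destruct (proj1 (continuity_pt_eps _ _) hg eps he) as [d [hd0 H]].
exists d; split; [exact hd0|]; intros y hy hne hyd.
assert (ex : exists c, Rabs (c - x) < d /\ (f y - f x) / (y - x) = g c).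
{ apply Rabs_def2 in hyd; destruct (Rtotal_order y x) as [h | [h | h]]; [| lra |].
  - destruct (mvt_open f g y x) as [c [hcyx e]]; [exact h | | |].
    + intros t ht; apply hd; lra.
    + intros t ht; apply hc; lra.
    + exists c; split; [apply Rabs_def1; lra|].
      apply Rmult_eq_reg_r with (y - x); [|lra]; field_simplify; lra.
  - destruct (mvt_open f g x y) as [c [hcyx e]]; [exact h | | |].
    + intros t ht; apply hd; lra.
    + intros t ht; apply hc; lra.
    + exists c; split; [apply Rabs_def1; lra|].
      apply Rmult_eq_reg_r with (y - x); [|lra]; field_simplify; lra. }
destruct ex as [c [hcd ->]]; apply H, hcd.
Qed.

Lemma is_derive_within_eps (D : R -> Prop) (f : R -> R) (x l : R) :
  is_derive_within D f x l <->
  forall eps, 0 < eps -> exists d, 0 < d /\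
    forall y, D y -> y <> x -> Rabs (y - x) < d -> Rabs ((f y - f x) / (y - x) - l) < eps.
Proof.
split.
- intros h eps he.
  destruct (proj1 (filterlim_locally _ _) h (mkposreal eps he)) as [d H].
  exists d; split; [apply cond_pos|]; intros y hy hne hyd; exact (H y hyd hne hy).
- intros h; apply filterlim_locally; intros eps.
  destruct (h eps (cond_pos eps)) as [d [hd H]].
  exists (mkposreal d hd); intros y hyd hne hy; exact (H y hy hne hyd).
Qed.

Lemma clamp_continuity_of_within (f : R -> R) (a b x l : R) :
  a <= x <= b -> is_derive_within (Icc a b) f x l ->
  continuity_pt (fun t => f (clamp a b t)) x.
Proof.
intros hx h; apply continuity_pt_eps; intros eps he.
destruct (proj1 (is_derive_within_eps _ _ _ _) h 1 Rlt_0_1) as [d [hd H]].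
set (A := Rabs l + 1); assert (hA : 0 < A) by (assert (H0 := Rabs_pos l); unfold A; lra).
assert (heA : 0 < eps / A) by (apply Rdiv_lt_0_compat; lra).
exists (Rmin d (eps / A)); split; [apply Rmin_glb_lt; lra|]; intros y hy.
assert (h1 := Rmin_l d (eps / A)); assert (h2 := Rmin_r d (eps / A)).
assert (hcl := clamp_lipschitz a b y x); assert (hcb := clamp_bounds a b y ltac:(lra)).
rewrite (clamp_id a b x) in hcl |- * by exact hx.
set (z := clamp a b y) in *.
destruct (Req_dec z x) as [-> | hne]; [rewrite Rminus_diag, Rabs_R0; exact he|].
specialize (H z hcb hne ltac:(lra)).
assert (hz : Rabs ((f z - f x) / (z - x)) < A).
{ replace ((f z - f x) / (z - x)) with (((f z - f x) / (z - x) - l) + l) by ring.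
  eapply Rle_lt_trans; [apply Rabs_triang|]; unfold A; lra. }
replace (f z - f x) with ((f z - f x) / (z - x) * (z - x)) by (field; lra).
rewrite Rabs_mult.
assert (hzx : Rabs (z - x) < eps / A) by lra.
assert (hp := Rabs_pos_lt (z - x) ltac:(lra)).
replace eps with (A * (eps / A)) by (field; lra).
apply Rmult_gt_0_lt_compat; lra.
Qed.

Lemma clamp_derive_of_within (f : R -> R) (a b x l : R) :
  a < x < b -> is_derive_within (Icc a b) f x l ->
  is_derive (fun t => f (clamp a b t)) x l.
Proof.
intros hx h; apply is_derive_Reals; intros eps he.
destruct (proj1 (is_derive_within_eps _ _ _ _) h eps he) as [d [hd H]].
assert (hd' : 0 < Rmin d (Rmin (x - a) (b - x))) by (repeat apply Rmin_glb_lt; lra).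
exists (mkposreal _ hd'); intros t ht htd; simpl in htd.
assert (h1 := Rmin_l d (Rmin (x - a) (b - x))); assert (h2 := Rmin_r d (Rmin (x - a) (b - x))).
assert (h3 := Rmin_l (x - a) (b - x)); assert (h4 := Rmin_r (x - a) (b - x)).
assert (htd' : Rabs t < d) by lra.
assert (htd2 : Rabs t < Rmin (x - a) (b - x)) by lra.
apply Rabs_def2 in htd2.
rewrite !clamp_id by lra.
assert (H1 : Rabs ((f (x + t) - f x) / (x + t - x) - l) < eps).
{ apply H; [unfold Icc; lra | lra | replace (x + t - x) with t by ring; exact htd']. }
replace (x + t - x) with t in H1 by ring; exact H1.
Qed.

Lemma nonneg_bound (u : R -> R) (a b : R) :
  a <= b -> (forall t, a <= t <= b -> continuity_pt u t) -> (forall t, a <= t <= b -> 0 <= u t) ->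
  exists K, 0 < K /\ forall t, a <= t <= b -> 0 <= u t <= K.
Proof.
intros hab hc hu; destruct (continuity_ab_maj u a b hab hc) as [x [hx hx']].
exists (u x + 1); split; [specialize (hu x hx'); lra|].
intros t ht; specialize (hx t ht); specialize (hu t ht); lra.
Qed.

Section BoundaryValueProblems.
Variables (p lambda : R).
Hypothesis (hp : 3 <= p) (hl : 0 < lambda).

(** A solution is arbitrary outside the closed interval, whereas [solves] asks for two-sided
    continuity at the endpoints; composing with [clamp] extends it by constants. *)
Lemma is_positive_solution_solves (alpha : R) (bc : boundary_condition) (u : R -> R) :
  0 < alpha -> is_positive_solution p lambda alpha bc u ->
  exists w w1, solves p lambda 1 (- alpha) alpha w w1 /\
    (forall t, - alpha <= t <= alpha -> w t = u t) /\
    (forall t, - alpha < t < alpha -> 0 < w t) /\ satisfies_bc bc alpha w w1.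
Proof.
intros ha [[u1 [u2 [[d1 [d2 c2]] [eq hbc]]]] hpos].
exists (fun t => u (clamp (- alpha) alpha t)), (fun t => u1 (clamp (- alpha) alpha t)).
refine (conj (conj _ (conj _ (conj _ _))) (conj _ (conj _ _))).
- intros t ht; eapply clamp_continuity_of_within, d1; exact ht.
- intros t ht; eapply clamp_continuity_of_within, d2; exact ht.
- intros t ht; rewrite clamp_id by lra.
  apply clamp_derive_of_within; [exact ht | apply d1; unfold Icc; lra].
- intros t ht; rewrite clamp_id by lra.
  replace (1 * u t * u1 t - nonlinearity p lambda (u t)) with (u2 t).
  + apply clamp_derive_of_within; [exact ht | apply d2; unfold Icc; lra].
  + specialize (eq t ht); unfold nonlinearity; lra.
- intros t ht; rewrite clamp_id by exact ht; reflexivity.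
- intros t ht; rewrite clamp_id by lra; auto.
- destruct bc; simpl in *; rewrite !clamp_id by lra; exact hbc.
Qed.

Lemma trunc_field_continuous (sigma a b K : R) (u v : R -> R) (t : R) :
  0 < K -> continuity_pt u t -> continuity_pt v t ->
  continuity_pt (fun t => sigma * u t * v t - trunc_nl p lambda K (u t)) t.
Proof.
intros hK hu hv.
destruct (trunc_lipschitz p lambda 1 K hp hl ltac:(lra) hK) as [C [hC [_ hd]]].
apply (continuity_pt_minus (fun t => sigma * u t * v t)).
- apply (continuity_pt_mult (fun t => sigma * u t)); [apply continuity_pt_scal, hu | exact hv].
- apply (continuity_pt_comp u (trunc_nl p lambda K)); [exact hu|].
  apply lipschitz_continuity_pt with C; assumption.
Qed.

(** The second derivative is given by the equation with the truncated nonlinearity: it is unchanged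
    on the interval, and being Lipschitz it is continuous also at endpoints where [u] vanishes and
    may change sign beyond. *)
Lemma solves_is_positive_solution (alpha : R) (bc : boundary_condition) (u v : R -> R) :
  0 < alpha -> solves p lambda 1 (- alpha) alpha u v ->
  (forall t, - alpha < t < alpha -> 0 < u t) -> satisfies_bc bc alpha u v ->
  is_positive_solution p lambda alpha bc u.
Proof.
intros ha hsol hpos hbc; split; [|exact hpos].
assert (hnn := solves_nonneg p lambda 1 (- alpha) alpha u v hsol hpos ltac:(lra)).
destruct hsol as [cu [cv [du dv]]].
destruct (nonneg_bound u (- alpha) alpha ltac:(lra) cu hnn) as [K [hK huK]].
set (u2 := fun t => 1 * u t * v t - trunc_nl p lambda K (u t)).
assert (e2 : forall t, - alpha <= t <= alpha ->
  1 * u t * v t - nonlinearity p lambda (u t) = u2 t).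
{ intros t ht; unfold u2, trunc_nl; rewrite clamp_id by auto; reflexivity. }
assert (c2 : forall t, - alpha <= t <= alpha -> continuity_pt u2 t).
{ intros t ht; apply trunc_field_continuous; auto. }
exists v, u2; split; [split; [|split]|split].
- intros x hx; apply is_derive_within_eps; apply slope_limit; auto.
- intros x hx; apply is_derive_within_eps; apply slope_limit; auto.
  intros t ht _; rewrite <- e2 by lra; auto.
- intros x hx; eapply filterlim_filter_le_1; [apply filter_le_within|].
  apply continuity_pt_filterlim, c2, hx.
- intros t ht; rewrite <- e2 by lra; unfold nonlinearity; ring.
- exact hbc.
Qed.

(** * Translation, reflection and gluing *)

Lemma solves_shift (sigma a b c : R) (u v : R -> R) :
  solves p lambda sigma a b u v ->
  solves p lambda sigma (a - c) (b - c) (fun t => u (c + t)) (fun t => v (c + t)).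
Proof.
assert (ds : forall t, is_derive (fun t => c + t) t 1) by (intros; auto_derive; [exact I | ring]).
assert (cs : forall t, continuity_pt (fun t => c + t) t)
  by (intros; eapply is_derive_continuity_pt, ds).
intros [h1 [h2 [h3 h4]]]; refine (conj _ (conj _ (conj _ _))); intros t ht.
- apply (continuity_pt_comp (fun t => c + t) u); [apply cs | apply h1; lra].
- apply (continuity_pt_comp (fun t => c + t) v); [apply cs | apply h2; lra].
- assert (H := is_derive_comp u (fun t => c + t) t _ _ (h3 (c + t) ltac:(lra)) (ds t)).
  refine (eq_rect _ (fun l => is_derive _ t l) H _ _).
  unfold scal; simpl; unfold mult; simpl; ring.
- assert (H := is_derive_comp v (fun t => c + t) t _ _ (h4 (c + t) ltac:(lra)) (ds t)).
  refine (eq_rect _ (fun l => is_derive _ t l) H _ _).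
  unfold scal; simpl; unfold mult; simpl; ring.
Qed.

Lemma solves_reflect (sigma a b c : R) (u v : R -> R) :
  solves p lambda sigma a b u v ->
  solves p lambda (- sigma) (c - b) (c - a) (fun t => u (c - t)) (fun t => - v (c - t)).
Proof.
assert (ds : forall t, is_derive (fun t => c - t) t (-1)) by (intros; auto_derive; [exact I | ring]).
assert (cs : forall t, continuity_pt (fun t => c - t) t)
  by (intros; eapply is_derive_continuity_pt, ds).
intros [h1 [h2 [h3 h4]]]; refine (conj _ (conj _ (conj _ _))); intros t ht.
- apply (continuity_pt_comp (fun t => c - t) u); [apply cs | apply h1; lra].
- apply continuity_pt_opp, (continuity_pt_comp (fun t => c - t) v); [apply cs | apply h2; lra].
- assert (H := is_derive_comp u (fun t => c - t) t _ _ (h3 (c - t) ltac:(lra)) (ds t)).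
  refine (eq_rect _ (fun l => is_derive _ t l) H _ _).
  unfold scal; simpl; unfold mult; simpl; ring.
- assert (H := is_derive_opp _ _ _
    (is_derive_comp v (fun t => c - t) t _ _ (h4 (c - t) ltac:(lra)) (ds t))).
  refine (eq_rect _ (fun l => is_derive _ t l) H _ _).
  unfold opp, scal; simpl; unfold mult; simpl; ring.
Qed.

(** In the mixed problem [c] is an endpoint, where positivity is not assumed; it holds because
    [u c = v c = 0] is impossible. *)
Lemma hits_right (c b : R) (u v : R -> R) :
  c < b -> solves p lambda 1 c b u v -> v c = 0 -> u b = 0 ->
  (forall t, c < t < b -> 0 < u t) ->
  hits p lambda 1 (u c) (b - c) (fun t => u (c + t)) (fun t => v (c + t)).
Proof.
intros hcb hsol vc ub hu.
assert (huc : 0 < u c).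
{ destruct (solves_nonneg p lambda 1 c b u v hsol hu hcb c ltac:(lra)) as [h | h]; [exact h|].
  exfalso; refine (solves_zero_slope p lambda hp hl 1 c b u v c _ hsol hu hcb _ _ vc); lra. }
refine (conj _ (conj _ (conj _ (conj _ (conj _ _))))).
- lra.
- assert (H := solves_shift 1 c b c u v hsol); rewrite Rminus_diag in H; exact H.
- f_equal; ring.
- rewrite Rplus_0_r; exact vc.
- intros t [[ht | <-] ht']; [apply hu; lra | rewrite Rplus_0_r; exact huc].
- replace (c + (b - c)) with b by ring; exact ub.
Qed.

Lemma hits_left (a c : R) (u v : R -> R) :
  a < c -> solves p lambda 1 a c u v -> v c = 0 -> u a = 0 ->
  (forall t, a < t < c -> 0 < u t) ->
  hits p lambda (-1) (u c) (c - a) (fun t => u (c - t)) (fun t => - v (c - t)).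
Proof.
intros hcb hsol vc ub hu.
assert (huc : 0 < u c).
{ destruct (solves_nonneg p lambda 1 a c u v hsol hu hcb c ltac:(lra)) as [h | h]; [exact h|].
  exfalso; refine (solves_zero_slope p lambda hp hl 1 a c u v c _ hsol hu hcb _ _ vc); lra. }
refine (conj _ (conj _ (conj _ (conj _ (conj _ _))))).
- lra.
- assert (H := solves_reflect 1 a c c u v hsol); rewrite Rminus_diag in H; exact H.
- f_equal; ring.
- rewrite Rminus_0_r, vc; ring.
- intros t [[ht | <-] ht']; [apply hu; lra | rewrite Rminus_0_r; exact huc].
- replace (c - (c - a)) with a by ring; exact ub.
Qed.

Lemma solves_of_punctured (sigma a b c : R) (u v : R -> R) :
  a < b ->
  (forall t, a <= t <= b -> continuity_pt u t) ->
  (forall t, a <= t <= b -> continuity_pt v t) ->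
  (forall t, a < t < b -> t <> c -> is_derive u t (v t)) ->
  (forall t, a < t < b -> t <> c ->
    is_derive v t (sigma * u t * v t - nonlinearity p lambda (u t))) ->
  (forall t, a <= t <= b -> 0 <= u t) -> solves p lambda sigma a b u v.
Proof.
intros hab cu cv du dv hu.
assert (fill : forall f g, (forall t, a <= t <= b -> continuity_pt f t) ->
  (forall t, a < t < b -> t <> c -> is_derive f t (g t)) ->
  (forall t, a <= t <= b -> continuity_pt g t) -> forall t, a < t < b -> is_derive f t (g t)).
{ intros f g cf df cg t ht; destruct (Req_dec t c) as [-> | hne]; [|auto].
  apply is_derive_Reals; intros eps he.
  destruct (slope_limit f g a b c cf df (cg c ltac:(lra)) ltac:(lra) eps he) as [d [hd H]].
  assert (hd' : 0 < Rmin d (Rmin (c - a) (b - c))) by (repeat apply Rmin_glb_lt; lra).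
  exists (mkposreal _ hd'); intros h hh hhd; simpl in hhd.
  assert (h1 := Rmin_l d (Rmin (c - a) (b - c))); assert (h2 := Rmin_r d (Rmin (c - a) (b - c))).
  assert (h3 := Rmin_l (c - a) (b - c)); assert (h4 := Rmin_r (c - a) (b - c)).
  assert (hd1 : Rabs h < d) by lra.
  assert (hd2 : Rabs h < Rmin (c - a) (b - c)) by lra.
  apply Rabs_def2 in hd2; specialize (H (c + h) ltac:(lra) ltac:(lra)).
  replace (c + h - c) with h in H by ring; apply H, hd1. }
destruct (nonneg_bound u a b ltac:(lra) cu hu) as [K [hK huK]].
refine (conj cu (conj cv (conj _ _))); [apply fill; assumption|].
assert (e2 : forall t, a <= t <= b -> trunc_nl p lambda K (u t) = nonlinearity p lambda (u t)).
{ intros t ht; unfold trunc_nl; rewrite clamp_id by auto; reflexivity. }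
intros t ht; rewrite <- e2 by lra.
apply (fill v (fun t => sigma * u t * v t - trunc_nl p lambda K (u t))); auto.
- intros s hs hne; rewrite e2 by lra; auto.
- intros s hs; apply trunc_field_continuous; auto.
Qed.

Definition glue (c : R) (f g : R -> R) (t : R) : R := if Rle_dec t c then f t else g t.

Lemma glue_left (c : R) (f g : R -> R) (t : R) : t <= c -> glue c f g t = f t.
Proof. intros h; unfold glue; destruct Rle_dec; [reflexivity | contradiction]. Qed.

Lemma glue_right (c : R) (f g : R -> R) (t : R) : f c = g c -> c <= t -> glue c f g t = g t.
Proof.
intros e h; unfold glue; destruct Rle_dec as [h' | h']; [|reflexivity].
replace t with c by lra; exact e.
Qed.

Lemma glue_continuity_pt (a b c : R) (f g : R -> R) :
  f c = g c -> (forall t, a <= t <= c -> continuity_pt f t) ->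
  (forall t, c <= t <= b -> continuity_pt g t) ->
  forall t, a <= t <= b -> continuity_pt (glue c f g) t.
Proof.
intros e cf cg t ht; apply continuity_pt_eps; intros eps he.
assert (L : t <= c -> exists d, 0 < d /\ forall y, y <= c -> Rabs (y - t) < d ->
  Rabs (glue c f g y - glue c f g t) < eps).
{ intros h; destruct (proj1 (continuity_pt_eps _ _) (cf t ltac:(lra)) eps he) as [d [hd H]].
  exists d; split; [exact hd|]; intros y hy hyd.
  rewrite !glue_left by assumption; auto. }
assert (Rt : c <= t -> exists d, 0 < d /\ forall y, c <= y -> Rabs (y - t) < d ->
  Rabs (glue c f g y - glue c f g t) < eps).
{ intros h; destruct (proj1 (continuity_pt_eps _ _) (cg t ltac:(lra)) eps he) as [d [hd H]].
  exists d; split; [exact hd|]; intros y hy hyd.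
  rewrite !glue_right by assumption; auto. }
destruct (Rtotal_order t c) as [h | [h | h]].
- destruct (L ltac:(lra)) as [d [hd H]]; exists (Rmin d (c - t)); split.
  { apply Rmin_glb_lt; lra. }
  intros y hy; assert (h1 := Rmin_l d (c - t)); assert (h2 := Rmin_r d (c - t)).
  assert (hy' : Rabs (y - t) < c - t) by lra; apply Rabs_def2 in hy'; apply H; lra.
- destruct (L ltac:(lra)) as [d [hd H]]; destruct (Rt ltac:(lra)) as [d' [hd' H']].
  exists (Rmin d d'); split; [apply Rmin_glb_lt; lra|].
  intros y hy; assert (h1 := Rmin_l d d'); assert (h2 := Rmin_r d d').
  destruct (Rle_lt_dec y c); [apply H; lra | apply H'; lra].
- destruct (Rt ltac:(lra)) as [d [hd H]]; exists (Rmin d (t - c)); split.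
  { apply Rmin_glb_lt; lra. }
  intros y hy; assert (h1 := Rmin_l d (t - c)); assert (h2 := Rmin_r d (t - c)).
  assert (hy' : Rabs (y - t) < t - c) by lra; apply Rabs_def2 in hy'; apply H; lra.
Qed.

(** Matching [u] and [v] at [c] suffices: the equation then makes the second derivatives match. *)
Lemma solves_glue (sigma a b c : R) (u1 v1 u2 v2 : R -> R) :
  a < c < b -> solves p lambda sigma a c u1 v1 -> solves p lambda sigma c b u2 v2 ->
  (forall t, a <= t <= c -> 0 <= u1 t) -> (forall t, c <= t <= b -> 0 <= u2 t) ->
  u1 c = u2 c -> v1 c = v2 c ->
  solves p lambda sigma a b (glue c u1 u2) (glue c v1 v2).
Proof.
intros hc [cu1 [cv1 [du1 dv1]]] [cu2 [cv2 [du2 dv2]]] p1 p2 eu ev.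
assert (dglue : forall f g df dg : R -> R, (forall t, a < t < c -> is_derive f t (df t)) ->
  (forall t, c < t < b -> is_derive g t (dg t)) ->
  forall t, a < t < b -> t <> c -> is_derive (glue c f g) t (glue c df dg t)).
{ intros f g df dg hf hg t ht hne; destruct (Rtotal_order t c) as [h | [h | h]]; [| lra |].
  - rewrite glue_left by lra.
    apply is_derive_ext_loc with f; [|apply hf; lra].
    exists (mkposreal (c - t) ltac:(lra)); intros y hy.
    rewrite glue_left; [reflexivity|].
    assert (hy' : Rabs (y - t) < c - t) by exact hy; apply Rabs_def2 in hy'; lra.
  - unfold glue at 2; destruct Rle_dec as [h' | _]; [lra|].
    apply is_derive_ext_loc with g; [|apply hg; lra].
    exists (mkposreal (t - c) ltac:(lra)); intros y hy.
    assert (hy' : Rabs (y - t) < t - c) by exact hy; apply Rabs_def2 in hy'.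
    unfold glue; destruct Rle_dec as [h' | _]; [lra | reflexivity]. }
apply solves_of_punctured with c; [lra | | | | |].
- apply glue_continuity_pt; auto.
- apply glue_continuity_pt; auto.
- apply dglue; auto.
- intros t ht hne; assert (H := dglue v1 v2 _ _ dv1 dv2 t ht hne).
  refine (eq_rect _ (fun l => is_derive _ t l) H _ _).
  unfold glue; destruct Rle_dec; reflexivity.
- intros t ht; unfold glue; destruct Rle_dec; [apply p1 | apply p2]; lra.
Qed.

Lemma constant_value : nonlinearity p lambda (Rpower lambda (/ (p - 1))) = 0.
Proof.
rewrite nonlinearity_pos by apply exp_pos.
rewrite Rpower_mult, Rinv_l, Rpower_1 by lra; ring.
Qed.

(** * Descents on intervals of length at most [l] *)

Variable (l : R).
Hypothesis (hl0 : 0 < l).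
Hypothesis (rigid : forall (sigma a b : R) (u v : R -> R),
    -1 <= sigma <= 1 -> a < b -> b - a <= l -> solves p lambda sigma a b u v ->
    (forall t, a <= t <= b -> 0 < u t) -> v a = 0 -> v b = 0 ->
    forall t, a <= t <= b -> v t = 0 /\ Rpower (u t) (p - 1) = lambda).

Lemma hits_lt_short (sigma m1 m2 L1 L2 : R) (u1 v1 u2 v2 : R -> R) :
  -1 <= sigma <= 1 -> L1 <= l -> L2 <= l ->
  hits p lambda sigma m1 L1 u1 v1 -> hits p lambda sigma m2 L2 u2 v2 -> m1 < m2 -> L2 < L1.
Proof.
intros hs h1 h2 H1 H2 hm.
eapply (hits_lt p lambda hp hl sigma m1 m2); eauto.
- eapply (hits_decreasing p lambda hp hl l rigid); eauto.
- eapply (hits_decreasing p lambda hp hl l rigid); eauto.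
Qed.

Lemma hits_nonneg (sigma m L : R) (u v : R -> R) :
  hits p lambda sigma m L u v -> forall t, 0 <= t <= L -> 0 <= u t.
Proof.
intros [_ [_ [_ [_ [h e]]]]] t ht; destruct (proj2 ht) as [h' | ->]; [|lra].
apply Rlt_le, h; lra.
Qed.

(** The two descents agree as long as both run. If one stopped strictly earlier, the other would
    still be positive at that time. *)
Lemma hits_unique (sigma m L1 L2 : R) (u1 v1 u2 v2 : R -> R) :
  -1 <= sigma <= 1 ->
  hits p lambda sigma m L1 u1 v1 -> hits p lambda sigma m L2 u2 v2 ->
  L1 = L2 /\ forall t, 0 <= t <= L1 -> u1 t = u2 t.
Proof.
intros hs.
assert (key : forall L1 L2 u1 v1 u2 v2, L1 <= L2 ->
  hits p lambda sigma m L1 u1 v1 -> hits p lambda sigma m L2 u2 v2 ->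
  L1 = L2 /\ forall t, 0 <= t <= L1 -> u1 t = u2 t).
{ clear - hp hl hs; intros L1 L2 u1 v1 u2 v2 hL H1 H2.
  assert (n1 := hits_nonneg _ _ _ _ _ H1); assert (n2 := hits_nonneg _ _ _ _ _ H2).
  destruct H1 as [h1 [s1 [a1 [b1 [p1 z1]]]]]; destruct H2 as [h2 [s2 [a2 [b2 [p2 z2]]]]].
  assert (E : forall t, 0 <= t <= L1 -> u1 t = u2 t).
  { intros t ht.
    apply (solves_unique p lambda hp hl sigma 0 L1 u1 v1 u2 v2 0 hs s1); try lra; auto.
    - apply (solves_restrict p lambda sigma 0 L2); [exact s2 | lra | exact hL].
    - intros s hs'; apply n2; lra. }
  split; [|exact E].
  destruct hL as [hL | hL]; [|exact hL].
  specialize (E L1 ltac:(lra)); specialize (p2 L1 ltac:(lra)); lra. }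
intros H1 H2; destruct (Rle_lt_dec L1 L2) as [h | h].
- exact (key L1 L2 u1 v1 u2 v2 h H1 H2).
- destruct (key L2 L1 u2 v2 u1 v1 ltac:(lra) H2 H1) as [-> E].
  split; [reflexivity | intros t ht; symmetry; auto].
Qed.

Lemma hits_same_length (sigma m1 m2 L : R) (u1 v1 u2 v2 : R -> R) :
  -1 <= sigma <= 1 -> L <= l ->
  hits p lambda sigma m1 L u1 v1 -> hits p lambda sigma m2 L u2 v2 ->
  forall t, 0 <= t <= L -> u1 t = u2 t.
Proof.
intros hs hL H1 H2.
destruct (Rtotal_order m1 m2) as [h | [<- | h]].
- assert (H := hits_lt_short sigma m1 m2 L L _ _ _ _ hs hL hL H1 H2 h); lra.
- exact (proj2 (hits_unique sigma m1 L L _ _ _ _ hs H1 H2)).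
- assert (H := hits_lt_short sigma m2 m1 L L _ _ _ _ hs hL hL H2 H1 h); lra.
Qed.

(** Shooting starts at the positive equilibrium: its solution is constant and never hits zero, which
    excludes the first alternative of [hits_exists]. *)
Lemma hits_each_length (sigma L : R) :
  -1 <= sigma <= 1 -> 0 < L -> exists m u v, hits p lambda sigma m L u v.
Proof.
intros hs hL.
set (k := Rpower lambda (/ (p - 1))).
destruct (hits_exists p lambda hp hl sigma L k hs hL) as [[L' [u [v [hL' H]]]] | [m [u [v [_ H]]]]].
- apply exp_pos.
- exfalso; assert (hn := hits_nonneg _ _ _ _ _ H).
  destruct H as [h0 [hsol [hu0 [hv0 [_ huL]]]]].
  assert (hk : 0 < k) by apply exp_pos.
  destruct (solves_unique p lambda hp hl sigma 0 L' u v (fun _ => k) (fun _ => 0) 0 hs hsol)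
    with (t := L') as [e _]; try lra; auto.
  + apply constant_solves, constant_value.
  + intros; lra.
- exists m, u, v; exact H.
Qed.

(** Here the second alternative of [hits_exists] is excluded: a peak above [m0] with the same length
    [L] would contradict strict monotonicity. *)
Lemma hits_larger (sigma L m0 m : R) (u0 v0 : R -> R) :
  -1 <= sigma <= 1 -> L <= l -> hits p lambda sigma m0 L u0 v0 -> m0 <= m ->
  exists L' u v, L' <= L /\ hits p lambda sigma m L' u v.
Proof.
intros hs hL H hm.
assert (hm0 : 0 < m0) by (destruct H as [h [_ [<- [_ [hu _]]]]]; apply hu; lra).
assert (hL0 : 0 < L) by apply H.
destruct (hits_exists p lambda hp hl sigma L m hs hL0) as [h | [m' [u [v [hm' H']]]]].
- lra.
- exact h.
- assert (h := hits_lt_short sigma m0 m' L L _ _ _ _ hs hL hL H H' ltac:(lra)); lra.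
Qed.

(* Both hitting lengths are decreasing functions of the peak [m], and they are
   continuous because they take every small value, so that their sum takes the
   value [S]. *)
Lemma hits_both_sides (S : R) :
  0 < S <= l -> exists m L1 L2 u1 v1 u2 v2,
    hits p lambda (-1) m L1 u1 v1 /\ hits p lambda 1 m L2 u2 v2 /\ L1 + L2 = S.
Proof.
intros hS.
set (H := fun sigma m L => exists u v, hits p lambda sigma m L u v).
assert (Hpos : forall sigma m L, H sigma m L -> 0 < L) by (intros s m L [u [v h]]; apply h).
assert (Hle : forall sigma m1 m2 L1 L2, -1 <= sigma <= 1 -> L1 <= l -> L2 <= l ->
  H sigma m1 L1 -> H sigma m2 L2 -> m1 <= m2 -> L2 <= L1).
{ intros sigma m1 m2 L1 L2 hs h1 h2 [u1 [v1 H1]] [u2 [v2 H2]] [hm | ->].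
  - apply Rlt_le; eapply (hits_lt_short sigma m1 m2); eauto.
  - destruct (hits_unique sigma m2 L1 L2 _ _ _ _ hs H1 H2); lra. }
assert (Hlt : forall sigma m1 m2 L1 L2, -1 <= sigma <= 1 -> L1 <= l -> L2 <= l ->
  H sigma m1 L1 -> H sigma m2 L2 -> L2 < L1 -> m1 < m2).
{ intros sigma m1 m2 L1 L2 hs h1 h2 H1 H2 hL; apply Rnot_le_lt; intros hm.
  assert (h := Hle sigma m2 m1 L2 L1 hs h2 h1 H2 H1 hm); lra. }
assert (s1 : -1 <= -1 <= 1) by lra; assert (s2 : -1 <= 1 <= 1) by lra.
destruct (hits_each_length (-1) S s1 (proj1 hS)) as [m1 H1]; fold (H (-1) m1 S) in H1.
destruct (hits_each_length 1 S s2 (proj1 hS)) as [m2 H2]; fold (H 1 m2 S) in H2.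
set (m0 := Rmax m1 m2).
assert (le1 : m1 <= m0) by apply Rmax_l; assert (le2 : m2 <= m0) by apply Rmax_r.
assert (ex : forall sigma n, -1 <= sigma <= 1 -> n <= m0 -> H sigma n S ->
  exists T : R -> R, forall m, m0 <= m -> 0 < T m <= S /\ H sigma m (T m)).
{ intros sigma n hs hn Hn.
  assert (exT : forall m, exists L, m0 <= m -> 0 < L <= S /\ H sigma m L).
  { intros m; destruct (Rle_lt_dec m0 m) as [h | h]; [|exists 0; intros; lra].
    destruct Hn as [u [v Hn]].
    destruct (hits_larger sigma S n m u v hs (proj2 hS) Hn ltac:(lra)) as [L [u' [v' [hL HL]]]].
    exists L; intros _; split; [split; [apply HL | exact hL] | exists u', v'; exact HL]. }
  exists (fun m => proj1_sig (constructive_indefinite_description _ (exT m))).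
  intros m; exact (proj2_sig (constructive_indefinite_description _ (exT m))). }
destruct (ex (-1) m1 s1 le1 H1) as [T1 hT1]; destruct (ex 1 m2 s2 le2 H2) as [T2 hT2].
(* The peak sought is the supremum of [A]. At [m0] one of the two lengths is exactly [S], so [A] is
   nonempty; peaks attaining [S / 3] on each side bound it. *)
set (A := fun m => m0 <= m /\ S <= T1 m + T2 m).
assert (A0 : A m0).
{ split; [lra|]; destruct (hT1 m0 ltac:(lra)) as [h1 h1']; destruct (hT2 m0 ltac:(lra)) as [h2 h2'].
  unfold m0 in *; destruct (Rle_lt_dec m1 m2) as [h | h].
  - rewrite Rmax_right in h2' |- * by exact h.
    rewrite Rmax_right in h1 by exact h.
    assert (h3 := Hle 1 m2 m2 (T2 m2) S s2 ltac:(rewrite Rmax_right in h2; lra) ltac:(lra) h2' H2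
      ltac:(lra)); lra.
  - rewrite Rmax_left in h1' |- * by lra.
    rewrite Rmax_left in h2 by lra.
    assert (h3 := Hle (-1) m1 m1 (T1 m1) S s1 ltac:(rewrite Rmax_left in h1; lra) ltac:(lra) h1' H1
      ltac:(lra)); lra. }
assert (upper : forall n1 n2 L1 L2, H (-1) n1 L1 -> H 1 n2 L2 -> L1 + L2 < S ->
  forall m, A m -> m <= Rmax n1 n2).
{ intros n1 n2 L1 L2 h1 h2 hL m [hm hA]; apply Rnot_lt_le; intros hlt.
  assert (g1 := Rmax_l n1 n2); assert (g2 := Rmax_r n1 n2).
  assert (q1 := Hpos _ _ _ h1); assert (q2 := Hpos _ _ _ h2).
  destruct (hT1 m hm) as [b1 t1]; destruct (hT2 m hm) as [b2 t2].
  assert (k1 := Hle (-1) n1 m L1 (T1 m) s1 ltac:(lra) ltac:(lra) h1 t1 ltac:(lra)).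
  assert (k2 := Hle 1 n2 m L2 (T2 m) s2 ltac:(lra) ltac:(lra) h2 t2 ltac:(lra)).
  lra. }
destruct (hits_each_length (-1) (S / 3) s1 ltac:(lra)) as [n1 N1].
destruct (hits_each_length 1 (S / 3) s2 ltac:(lra)) as [n2 N2].
destruct (completeness A) as [M [ub lub]].
{ exists (Rmax n1 n2); intros m; apply (upper n1 n2 (S / 3) (S / 3) N1 N2); lra. }
{ exists m0; exact A0. }
assert (hM : m0 <= M) by (apply ub, A0).
destruct (hT1 M hM) as [b1 [u1 [v1 t1]]]; destruct (hT2 M hM) as [b2 [u2 [v2 t2]]].
assert (t1' : H (-1) M (T1 M)) by (exists u1, v1; exact t1).
assert (t2' : H 1 M (T2 M)) by (exists u2, v2; exact t2).
exists M, (T1 M), (T2 M), u1, v1, u2, v2; split; [exact t1 | split; [exact t2|]].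
destruct (Rtotal_order (T1 M + T2 M) S) as [h | [h | h]]; [exfalso | exact h | exfalso].
(* Sum too small: peaks attaining the lengths enlarged by [d] still have a total below [S], so they
   bound [A] from above, yet both lie below its supremum. *)
- set (d := (S - (T1 M + T2 M)) / 3).
  destruct (hits_each_length (-1) (T1 M + d) s1 ltac:(unfold d; lra)) as [q1 Q1].
  destruct (hits_each_length 1 (T2 M + d) s2 ltac:(unfold d; lra)) as [q2 Q2].
  assert (hq1 : q1 < M).
  { apply (Hlt (-1) q1 M (T1 M + d) (T1 M) s1); auto; unfold d; lra. }
  assert (hq2 : q2 < M).
  { apply (Hlt 1 q2 M (T2 M + d) (T2 M) s2); auto; unfold d; lra. }
  assert (M <= Rmax q1 q2).
  { apply lub; intros m; apply (upper q1 q2 _ _ Q1 Q2); unfold d; lra. }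
  revert H0; apply Rmax_case; lra.
(* Sum too large: peaks attaining the lengths reduced by [d] lie above [M], and the smaller of them
   is still in [A]. The bounds by halves keep the reduced lengths positive. *)
- set (d := Rmin ((T1 M + T2 M - S) / 2) (Rmin (T1 M / 2) (T2 M / 2))).
  assert (d1 : d <= (T1 M + T2 M - S) / 2) by apply Rmin_l.
  assert (d2 : d <= Rmin (T1 M / 2) (T2 M / 2)) by apply Rmin_r.
  assert (d3 := Rmin_l (T1 M / 2) (T2 M / 2)); assert (d4 := Rmin_r (T1 M / 2) (T2 M / 2)).
  assert (d0 : 0 < d) by (unfold d; repeat apply Rmin_glb_lt; lra).
  destruct (hits_each_length (-1) (T1 M - d) s1 ltac:(lra)) as [q1 Q1].
  destruct (hits_each_length 1 (T2 M - d) s2 ltac:(lra)) as [q2 Q2].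
  assert (hq1 : M < q1) by (apply (Hlt (-1) M q1 (T1 M) (T1 M - d) s1); auto; lra).
  assert (hq2 : M < q2) by (apply (Hlt 1 M q2 (T2 M) (T2 M - d) s2); auto; lra).
  assert (hmin : M < Rmin q1 q2) by (apply Rmin_glb_lt; assumption).
  assert (g1 := Rmin_l q1 q2); assert (g2 := Rmin_r q1 q2).
  assert (hm0 : m0 <= Rmin q1 q2) by lra.
  destruct (hT1 _ hm0) as [b3 t3]; destruct (hT2 _ hm0) as [b4 t4].
  assert (k1 := Hle (-1) (Rmin q1 q2) q1 (T1 (Rmin q1 q2)) (T1 M - d) s1 ltac:(lra) ltac:(lra) t3 Q1 g1).
  assert (k2 := Hle 1 (Rmin q1 q2) q2 (T2 (Rmin q1 q2)) (T2 M - d) s2 ltac:(lra) ltac:(lra) t4 Q2 g2).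
  assert (Rmin q1 q2 <= M); [|lra].
  apply ub; split; lra.
Qed.

(** In the mixed problems the peak is an endpoint and the descent has length [l], which fixes its
    height. In the Neumann problem a zero at an endpoint is excluded by the nonzero slope there, so
    rigidity applies on the closed interval. *)
Lemma solves_bvp_unique (bc : boundary_condition) (u u1 w w1 : R -> R) :
  solves p lambda 1 (- (l / 2)) (l / 2) u u1 -> solves p lambda 1 (- (l / 2)) (l / 2) w w1 ->
  (forall t, - (l / 2) < t < l / 2 -> 0 < u t) -> (forall t, - (l / 2) < t < l / 2 -> 0 < w t) ->
  satisfies_bc bc (l / 2) u u1 -> satisfies_bc bc (l / 2) w w1 ->
  forall t, - (l / 2) <= t <= l / 2 -> u t = w t.
Proof.
set (a := l / 2); assert (ha : 0 < a) by (unfold a; lra); assert (hal : a + a = l) by (unfold a; field).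
intros su sw pu pw bu bw t ht.
assert (s1 : -1 <= -1 <= 1) by lra; assert (s2 : -1 <= 1 <= 1) by lra.
destruct bc; simpl in bu, bw; destruct bu as [bu1 bu2]; destruct bw as [bw1 bw2].
- assert (peak : forall u u1, solves p lambda 1 (- a) a u u1 -> (forall t, - a < t < a -> 0 < u t) ->
    u (- a) = 0 -> u a = 0 -> exists c, - a < c < a /\
    hits p lambda (-1) (u c) (c - - a) (fun t => u (c - t)) (fun t => - u1 (c - t)) /\
    hits p lambda 1 (u c) (a - c) (fun t => u (c + t)) (fun t => u1 (c + t))).
  { clear - hp hl ha; intros u u1 su pu b1 b2.
    destruct (mvt_open u u1 (- a) a) as [c [hc e]]; [lra | apply su | apply su|].
    assert (u1c : u1 c = 0) by (apply Rmult_eq_reg_r with (a - - a); lra).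
    exists c; split; [exact hc | split].
    - apply hits_left; auto; [lra | | intros; apply pu; lra].
      apply (solves_restrict p lambda 1 (- a) a); [exact su | lra | lra].
    - apply hits_right; auto; [lra | | intros; apply pu; lra].
      apply (solves_restrict p lambda 1 (- a) a); [exact su | lra | lra]. }
  destruct (peak u u1 su pu bu1 bu2) as [c [hc [lu ru]]].
  destruct (peak w w1 sw pw bw1 bw2) as [d [hd [lw rw]]].
  (* Of two different peaks, the higher one would have strictly shorter descents on both sides,
     although both pairs of lengths add up to [l]. Equal peaks have equal lengths, hence the same
     position. *)
  destruct (Rtotal_order (u c) (w d)) as [h | [h | h]].
  + assert (k1 := hits_lt_short (-1) (u c) (w d) (c - - a) (d - - a) _ _ _ _ s1 ltac:(lra) ltac:(lra) lu lw h).
    assert (k2 := hits_lt_short 1 (u c) (w d) (a - c) (a - d) _ _ _ _ s2 ltac:(lra) ltac:(lra) ru rw h); lra.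
  + rewrite <- h in lw, rw.
    destruct (hits_unique _ _ _ _ _ _ _ _ s1 lu lw) as [e1 E1].
    destruct (hits_unique _ _ _ _ _ _ _ _ s2 ru rw) as [e2 E2].
    assert (ecd : d = c) by lra; subst d.
    destruct (Rle_lt_dec t c) as [h' | h'].
    * specialize (E1 (c - t) ltac:(lra)); simpl in E1.
      replace (c - (c - t)) with t in E1 by ring; exact E1.
    * specialize (E2 (t - c) ltac:(lra)); simpl in E2.
      replace (c + (t - c)) with t in E2 by ring; exact E2.
  + assert (k1 := hits_lt_short (-1) (w d) (u c) (d - - a) (c - - a) _ _ _ _ s1 ltac:(lra) ltac:(lra) lw lu h).
    assert (k2 := hits_lt_short 1 (w d) (u c) (a - d) (a - c) _ _ _ _ s2 ltac:(lra) ltac:(lra) rw ru h); lra.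
- assert (val : forall u u1, solves p lambda 1 (- a) a u u1 -> (forall t, - a < t < a -> 0 < u t) ->
    u1 (- a) = 0 -> u1 a = 0 -> u t = Rpower lambda (/ (p - 1))).
  { clear - hp hl ha hal rigid ht s2; intros u u1 su pu b1 b2.
    assert (pos : forall s, - a <= s <= a -> 0 < u s).
    { assert (hab : - a < a) by lra; intros s hs.
      destruct (solves_nonneg p lambda 1 (- a) a u u1 su pu hab s hs) as [h | h]; [exact h|].
      assert (hz := solves_zero_slope p lambda hp hl 1 (- a) a u u1 s s2 su pu hab hs (eq_sym h)).
      destruct (proj1 hs) as [h1 | <-]; [|contradiction].
      destruct (proj2 hs) as [h2 | ->]; [|contradiction].
      apply pu; lra. }
    destruct (rigid 1 (- a) a u u1 s2 ltac:(lra) ltac:(lra) su pos b1 b2 t ht) as [_ e].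
    rewrite <- e, Rpower_mult, Rinv_r, Rpower_1 by (auto; lra); reflexivity. }
  rewrite (val u u1), (val w w1); auto.
- assert (su' := hits_left (- a) a u u1 ltac:(lra) su bu2 bu1 pu).
  assert (sw' := hits_left (- a) a w w1 ltac:(lra) sw bw2 bw1 pw).
  assert (E := hits_same_length (-1) (u a) (w a) (a - - a) _ _ _ _ s1 ltac:(lra) su' sw' (a - t) ltac:(lra)).
  simpl in E; replace (a - (a - t)) with t in E by ring; exact E.
- assert (su' := hits_right (- a) a u u1 ltac:(lra) su bu1 bu2 pu).
  assert (sw' := hits_right (- a) a w w1 ltac:(lra) sw bw1 bw2 pw).
  assert (E := hits_same_length 1 (u (- a)) (w (- a)) (a - - a) _ _ _ _ s2 ltac:(lra) su' sw' (t - - a) ltac:(lra)).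
  simpl in E; replace (- a + (t - - a)) with t in E by ring; exact E.
Qed.

Lemma hits_solves_right (m L c : R) (u v : R -> R) :
  hits p lambda 1 m L u v ->
  solves p lambda 1 c (c + L) (fun t => u (- c + t)) (fun t => v (- c + t)).
Proof.
intros [_ [h _]]; assert (H := solves_shift 1 0 L (- c) u v h).
replace (0 - - c) with c in H by ring; replace (L - - c) with (c + L) in H by ring; exact H.
Qed.

Lemma hits_solves_left (m L c : R) (u v : R -> R) :
  hits p lambda (-1) m L u v ->
  solves p lambda 1 (c - L) c (fun t => u (c - t)) (fun t => - v (c - t)).
Proof.
intros [_ [h _]]; assert (H := solves_reflect (-1) 0 L c u v h).
rewrite Rminus_0_r in H; replace (- (-1)) with 1 in H by ring; exact H.
Qed.

Lemma solves_bvp_exists (bc : boundary_condition) :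
  exists u v, solves p lambda 1 (- (l / 2)) (l / 2) u v /\
    (forall t, - (l / 2) < t < l / 2 -> 0 < u t) /\ satisfies_bc bc (l / 2) u v.
Proof.
set (a := l / 2); assert (ha : 0 < a) by (unfold a; lra); assert (hal : a + a = l) by (unfold a; field).
assert (s1 : -1 <= -1 <= 1) by lra; assert (s2 : -1 <= 1 <= 1) by lra.
destruct bc.
- destruct (hits_both_sides l ltac:(lra)) as [m [L1 [L2 [u1 [v1 [u2 [v2 [H1 [H2 hL]]]]]]]]].
  (* Position of the peak: [c - L1 = - a], and [c + L2 = a] because [L1 + L2 = l]. *)
  set (c := L1 - a).
  assert (S1 := hits_solves_left m L1 c u1 v1 H1); assert (S2 := hits_solves_right m L2 c u2 v2 H2).
  replace (c - L1) with (- a) in S1 by (unfold c; ring).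
  replace (c + L2) with a in S2 by (unfold c; lra).
  assert (n1 := hits_nonneg _ _ _ _ _ H1); assert (n2 := hits_nonneg _ _ _ _ _ H2).
  destruct H1 as [h1 [_ [a1 [b1 [p1 z1]]]]]; destruct H2 as [h2 [_ [a2 [b2 [p2 z2]]]]].
  assert (hc : - a < c < a) by (unfold c; lra).
  exists (glue c (fun t => u1 (c - t)) (fun t => u2 (- c + t))),
    (glue c (fun t => - v1 (c - t)) (fun t => v2 (- c + t))).
  assert (eu : u1 (c - c) = u2 (- c + c)).
  { rewrite Rminus_diag, Rplus_opp_l, a1, a2; reflexivity. }
  assert (ev : - v1 (c - c) = v2 (- c + c)).
  { rewrite Rminus_diag, Rplus_opp_l, b1, b2; ring. }
  split; [|split].
  + apply solves_glue; auto; intros t ht; [apply n1 | apply n2]; unfold c in *; lra.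
  + intros t ht; unfold glue; destruct Rle_dec as [h | h]; [apply p1 | apply p2]; unfold c in *; lra.
  + simpl; split.
    * rewrite glue_left by lra; replace (c - - a) with L1 by (unfold c; ring); exact z1.
    * rewrite glue_right by (auto; lra); replace (- c + a) with L2 by (unfold c; lra); exact z2.
- exists (fun _ => Rpower lambda (/ (p - 1))), (fun _ => 0); split; [|split].
  + apply constant_solves, constant_value.
  + intros; apply exp_pos.
  + split; reflexivity.
- destruct (hits_each_length (-1) l s1 hl0) as [m [u [v H]]].
  exists (fun t => u (a - t)), (fun t => - v (a - t)); split; [|split].
  + assert (S1 := hits_solves_left m l a u v H).
    replace (a - l) with (- a) in S1 by lra; exact S1.
  + intros t ht; destruct H as [_ [_ [_ [_ [h _]]]]]; apply h; lra.
  + destruct H as [_ [_ [_ [hv [_ hu]]]]]; split.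
    * replace (a - - a) with l by lra; exact hu.
    * rewrite Rminus_diag, hv; ring.
- destruct (hits_each_length 1 l s2 hl0) as [m [u [v H]]].
  exists (fun t => u (- - a + t)), (fun t => v (- - a + t)); split; [|split].
  + assert (S2 := hits_solves_right m l (- a) u v H).
    replace (- a + l) with a in S2 by lra; exact S2.
  + intros t ht; destruct H as [_ [_ [_ [_ [h _]]]]]; apply h; lra.
  + destruct H as [_ [_ [_ [hv [_ hu]]]]]; split.
    * replace (- - a + - a) with 0 by ring; exact hv.
    * replace (- - a + a) with l by lra; exact hu.
Qed.

End BoundaryValueProblems.

Theorem theorem2p4 (p lambda : R) (hp : 3 <= p) (hlambda : 0 < lambda) :
  exists alpha : R, 0 < alpha /\
    forall bc : boundary_condition,
      exists u : R -> R,
        is_positive_solution p lambda alpha bc u /\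
        (forall v : R -> R, is_positive_solution p lambda alpha bc v ->
           forall x, - alpha <= x <= alpha -> v x = u x).
Proof.
destruct (neumann_rigidity p lambda hp hlambda) as [l [hl rigid]].
assert (ha : 0 < l / 2) by lra.
exists (l / 2); split; [exact ha|]; intros bc.
destruct (solves_bvp_exists p lambda hp hlambda l hl rigid bc) as [u [u1 [hu [pu bu]]]].
exists u; split; [apply (solves_is_positive_solution p lambda hp hlambda _ bc u u1); assumption|].
intros v hv x hx.
destruct (is_positive_solution_solves p lambda _ bc v ha hv) as [w [w1 [hw [e [pw bw]]]]].
rewrite <- e by exact hx.
exact (solves_bvp_unique p lambda hp hlambda l hl rigid bc w w1 u u1 hw hu pw pu bw bu x hx).
Qed.
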